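(* Let $X$ be a complex Banach space, $I=[0,1]$, and $p\in\mathbb{N}=\{1,2,\dots\}$. Suppose that for every $t\in I$ the operator $A(t):D(A(t))\subset X\to X$ is the generator of a strongly continuous semigroup on $X$ and that the family $A=(A(t))_{t\in I}$ is $(M,\omega)$-stable for some $M\in[1,\infty)$ and $\omega\in\mathbb{R}$. Suppose that there are closed operators $C^{(k)}(s_1,\dots,s_{k+1})$ in $X$ for $k\in\{0,\dots,p-1\}$ and $s_1,\dots,s_{k+1}\in I$, with $C^{(0)}(s)=A(s)$, and complex numbers $\mu(t_1,\dots,t_{p+1})\in\mathbb{C}$ for $t_1,\dots,t_{p+1}\in I$, such that $$C^{(k)}(\underline{s})\,e^{A(t)\tau}\supset e^{A(t)\tau}\Big(C^{(k)}(\underline{s})+C^{(k+1)}(\underline{s},t)\,\tau+\dots+C^{(p-1)}(\underline{s},t,\dots,t)\,\frac{\tau^{p-1-k}}{(p-1-k)!}+\mu(\underline{s},t,\dots,t)\,\frac{\tau^{p-k}}{(p-k)!}\Big)$$ for all $k\in\{0,\dots,p-1\}$, $\underline{s}=(s_1,\dots,s_{k+1})\in I^{k+1}$, $t\in I$ and $\tau\in[0,\infty)$. Suppose further that the maximal continuity subspace $$Y^{\circ}:=\bigcap_{k=0}^{p-1}\Big\{y\in D_k:\ (t_1,\dots,t_{k+1})\mapsto C^{(k)}(t_1,\dots,t_{k+1})y\text{ is continuous on } I^{k+1}\Big\},\qquad D_k:=\bigcap_{\tau_1,\dots,\tau_{k+1}\in I}D\big(C^{(k)}(\tau_1,\dots,\tau_{k+1})\big),$$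 is dense in $X$ and that $(t_1,\dots,t_{p+1})\mapsto\mu(t_1,\dots,t_{p+1})$ is continuous on $I^{p+1}$. Then there exists a unique evolution system $U$ for $A$ on $Y^{\circ}$.
   Context: Write $\Delta=\{(s,t)\in I^2:s\le t\}$. An inclusion $S\supset T$ of (possibly unbounded) operators means that $S$ extends $T$; sums and products of operators have their natural domains. $e^{B\,\cdot}$ denotes the strongly continuous semigroup generated by $B$. In the commutation relation, the sum inside the parentheses consists of the terms $C^{(k+j)}(\underline{s},t,\dots,t)\tau^j/j!$ ($j$ copies of $t$) for $j=0,\dots,p-1-k$, plus the scalar term with $p-k$ copies of $t$ in $\mu$. $(M,\omega)$-stability: a family $A$ of semigroup generators $A(t)$, $t\in I$, on $X$ is $(M,\omega)$-stable if $\|e^{A(t_n)s_n}\cdots e^{A(t_1)s_1}\|\le Me^{\omega(s_1+\dots+s_n)}$ for all $n\in\mathbb{N}$, all $t_1,\dots,t_n\in I$ with $t_n\ge\dots\ge t_1$, and all $s_1,\dots,s_n\in[0,\infty)$. Evolution system: let $Y$ be a dense subspace of $X$ contained in $\bigcap_{\tau\in I}D(A(\tau))$. An evolution system for $A$ on $Y$ is a family of bounded operators $U(t,s)$ on $X$, $(s,t)\in\Delta$, such that (i) for every $y\in Y$ and $s\in[0,1)$ the map $[s,1]\ni t\mapsto U(t,s)y$ is a continuously differentiable solution, with values in $Y$, of the initial value problem $x'(t)=A(t)x(t)$ $(t\in[s,1])$, $x(s)=y$; (ii) $U(t,s)U(s,r)=U(t,r)$ for all $r\le s\le t$ in $I$,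 and $\Delta\ni(s,t)\mapsto U(t,s)$ is strongly continuous. *)

(* Defs.v *)
From HB Require Import structures.
From mathcomp Require Import all_boot all_order all_algebra.
From mathcomp Require Import all_classical all_reals all_analysis.
From mathcomp Require Import complex.

Set Implicit Arguments.
Unset Strict Implicit.
Unset Printing Implicit Defensive.

Import Order.TTheory GRing.Theory Num.Theory.
Import numFieldNormedType.Exports.
Local Open Scope classical_set_scope.
Local Open Scope ring_scope.
Local Open Scope complex_scope.

(* A complex Banach space is an
   [X : completeNormedModType R[i]] with [R : realType]; its norm takes its
   values in R[i], and real quantities are injected by [r%:C]. *)

(** * Unbounded operators *)

(* The values of [op_app B] outside [op_dom B] are irrelevant. *)
Record operator (X : Type) := Operator {
  op_dom : set X;
  op_app :> X -> X
}.

Section Operators.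
Variables (R : realType) (X : normedModType R[i]).
Implicit Types (B S T : operator X) (f : X -> X) (c : R[i]).

Definition is_subspace (Y : set X) : Prop :=
  Y 0 /\ forall (c : R[i]) (x y : X), Y x -> Y y -> Y (c *: x + y).

Definition linear_operator B : Prop :=
  is_subspace (op_dom B) /\
  forall (c : R[i]) (x y : X), op_dom B x -> op_dom B y ->
    B (c *: x + y) = c *: B x + B y.

Definition op_graph B : set (X * X) :=
  [set xy | op_dom B xy.1 /\ xy.2 = B xy.1].

Definition closed_operator B : Prop :=
  linear_operator B /\ closed (op_graph B).

(* [op_ext S T] is the inclusion S ⊃ T. *)
Definition op_ext S T : Prop :=
  op_dom T `<=` op_dom S /\ forall x, op_dom T x -> S x = T x.

Definition op_eq S T : Prop := op_ext S T /\ op_ext T S.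

Definition op_of f : operator X := Operator setT f.

Definition op_comp S T : operator X :=
  Operator [set x | op_dom T x /\ op_dom S (T x)] (fun x => S (T x)).

Definition op_add S T : operator X :=
  Operator (op_dom S `&` op_dom T) (fun x => S x + T x).

(* The domain is that of [B], also for [c = 0]. *)
Definition op_scale c B : operator X :=
  Operator (op_dom B) (fun x => c *: B x).

Definition op_sum n (B : 'I_n -> operator X) : operator X :=
  Operator [set x | forall j, op_dom (B j) x] (fun x => \sum_(j < n) B j x).

Definition bounded_operator f : Prop :=
  (forall (c : R[i]) (x y : X), f (c *: x + y) = c *: f x + f y) /\
  exists K : R, forall x, `|f x| <= K%:C * `|x|.

(* ‖f‖ <= K, for K >= 0 *)
Definition opnorm_le f (K : R) : Prop := forall x, `|f x| <= K%:C * `|x|.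

End Operators.

(** * Strongly continuous semigroups and their generators *)

Section Semigroups.
Variables (R : realType) (X : completeNormedModType R[i]).
Implicit Types (T : R -> X -> X) (B : operator X).

(* Only the values [T h] with [0 <= h] are constrained. *)
Definition C0_semigroup T : Prop :=
  [/\ forall h : R, 0 <= h -> bounded_operator (T h),
      forall x, T 0 x = x,
      forall (g h : R) x, 0 <= g -> 0 <= h -> T (g + h) x = T g (T h x)
    & forall x, {within [set h : R | 0 <= h], continuous (fun h => T h x)}].

Definition generator_quotient T (x : X) (h : R) : X :=
  (h^-1)%:C *: (T h x - x).

Definition generator T : operator X :=
  Operator [set x | cvg (generator_quotient T x h @[h --> (0 : R)^'+])]
           (fun x => lim (generator_quotient T x h @[h --> (0 : R)^'+])).

(* [T] is the semigroup e^{B .}; it is determined by [B] on [0, oo). *)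
Definition generates B T : Prop := C0_semigroup T /\ op_eq B (generator T).

End Semigroups.

(** * Families indexed by I = [0,1] *)

Section Families.
Variables (R : realType) (X : completeNormedModType R[i]).
Implicit Types (A : R -> operator X) (E : R -> R -> X -> X).

Definition unitI : set R := [set t | 0 <= t <= 1].

Definition cube n : set 'rV[R]_n := [set s | forall i, unitI (s ord0 i)].

(* (s_1, ..., s_{k+1}, t, ..., t), of total length n (for k < n) *)
Definition pad n k (s : 'rV[R]_k.+1) (t : R) : 'rV[R]_n :=
  \row_(i < n) if (i <= k)%N then s ord0 (inord i) else t.

(* For [l = [:: (t_1, s_1); ...; (t_n, s_n)]] and [E t] the semigroup
   e^{A(t) .}, this is e^{A(t_n) s_n} ... e^{A(t_1) s_1} x. *)
Definition semigroup_prod E (l : seq (R * R)) (x : X) : X :=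
  foldl (fun y ts => E ts.1 ts.2 y) x l.

(* [E t] is the semigroup e^{A(t) .} *)
Definition stable E (M omega : R) : Prop :=
  forall l : seq (R * R),
    (forall ts, ts \in l -> unitI ts.1 /\ 0 <= ts.2) ->
    sorted <=%R [seq ts.1 | ts <- l] ->
    opnorm_le (semigroup_prod E l)
              (M * expR (omega * \sum_(ts <- l) ts.2)).

(* [l] is the derivative at [t] of [f] restricted to [D], one-sided when [t]
   is an end point of the interval [D]. *)
Definition has_deriv_within (D : set R) (f : R -> X) (t : R) (l : X) : Prop :=
  (h^-1)%:C *: (f (t + h) - f t)
    @[h --> within [set h | D (t + h)] (0 : R)^'] --> l.

(* [x] is a C^1 solution of x' = A x on [s, 1], x(s) = y, with values in Y. *)
Definition C1_solution A (Y : set X) (s : R) (y : X) (x : R -> X) : Prop :=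
  let J := [set t : R | s <= t <= 1] in
  [/\ x s = y,
      forall t, J t -> Y (x t) /\ op_dom (A t) (x t)
    & exists x' : R -> X,
      [/\ forall t, J t -> has_deriv_within J x t (x' t),
          {within J, continuous x'}
        & forall t, J t -> x' t = A t (x t)]].

(* The map [U t s] is U(t,s); only its values for (s,t) in Delta matter. *)
Definition evolution_system A (Y : set X) (U : R -> R -> X -> X) : Prop :=
  [/\ [/\ is_subspace Y, dense Y
        & forall t, unitI t -> Y `<=` op_dom (A t)],
      forall s t, 0 <= s -> s <= t -> t <= 1 -> bounded_operator (U t s),
      forall y s, Y y -> 0 <= s -> s < 1 ->
        C1_solution A Y s y (fun t => U t s y),
      forall r s t x, 0 <= r -> r <= s -> s <= t -> t <= 1 ->
        U t s (U s r x) = U t r x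
    & forall x, {within [set st : R * R |
                           [/\ unitI st.1, unitI st.2 & st.1 <= st.2]],
                 continuous (fun st : R * R => U st.2 st.1 x)}].

(* C^{(k)}(s_1, ..., s_{k+1}) is [C k s] with [s] of length k+1. *)
Implicit Type C : forall k : nat, 'rV[R]_k.+1 -> operator X.

(* The operator in parentheses in the commutation relation; the term with
   index j carries j copies of [t]. *)
Definition commutator_sum (p : nat) C (mu : 'rV[R]_p.+1 -> R[i])
    (k : nat) (s : 'rV[R]_k.+1) (t tau : R) : operator X :=
  op_add
    (op_sum (fun j : 'I_(p - k) =>
       op_scale (tau ^+ j / j`!%:R)%:C (C (k + j)%N (pad (k + j).+1 s t))))
    (op_of (fun x => (mu (pad p.+1 s t) *
                      (tau ^+ (p - k) / (p - k)`!%:R)%:C) *: x)).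

Definition max_cont_subspace (p : nat) C : set X :=
  [set y | forall k, (k < p)%N ->
     (forall s, cube s -> op_dom (C k s) y) /\
     {within @cube k.+1, continuous (fun s => C k s y)}].

End Families.

(* Main.v *)
Require Import Defs.
From HB Require Import structures.
From mathcomp Require Import all_boot all_order all_algebra.
From mathcomp Require Import all_classical all_reals all_analysis.
From mathcomp Require Import complex zify ring lra.

Set Implicit Arguments.
Unset Strict Implicit.
Unset Printing Implicit Defensive.

Import Order.TTheory GRing.Theory Num.Theory.
Import numFieldNormedType.Exports.
Local Open Scope classical_set_scope.
Local Open Scope ring_scope.
Local Open Scope complex_scope.

(** Freeze the generator on each cell of a uniform partition of [0,1] at the left
    end point of the cell and let U_n(t,s) be the resulting ordered product of
    semigroups (approx). Stability bounds these products uniformly, so everything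
    depends on comparing two of them on the dense subspace Y of vectors y on which
    all the operators C^(k) are defined and continuous in their parameters.

    The commutation relation says that C^(k) passes through a semigroup
    e^{A(a)h} at the price of a Taylor sum of higher commutators. It is
    convenient to regard all the vectors C^(k)(s_1, ..., s_(k+1)) y, together with
    mu(s_1, ..., s_(p+1)) y, as one family H indexed by lists l of parameters
    (coeff). If N_a is the nilpotent shift (N_a H)(l) = H(l, a), then the family of
    e^{A(a)h} y is e^{A(a)h} applied to exp(h N_a) H (semigroup_coeff). Iterating
    over all factors, C(l) U_n(t,s) y = U_n(t,s) (G_n(t,s) H)(l), where G_n(t,s) is
    the ordered product of the maps exp(h N_a) with the same nodes and durations
    (approx_coeffE). Thus the unbounded operators act on the fixed vector y only,
    and G_n is an elementary object: it preserves bounds and moduli of continuity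
    of H up to a constant independent of n, and it converges uniformly
    (approx_coeff_cauchy), because at the top level the family is constant in time
    and at each lower level the time derivative is the next higher level.

    Every passage from infinitesimal to finite differences is made with a mean
    value inequality that needs forward increments only (mean_value). Applied to
    r |-> U_n(t,r) U_m(r,s) y, whose forward derivative is
    U_n(t,r) (A(b) - A(a)) U_m(r,s) y with nodes a, b close to r, it shows that
    U_n(t,s) y is a Cauchy sequence, uniformly in s and t (approx_cauchy); density
    and the uniform bound extend this to all vectors and give the limit U.
    Closedness of the operators C^(k) turns the commutation formula for U_n into
    the same formula for U (propagator_coeffE), so U leaves Y invariant. Applied to
    r |-> U_n(r,s) y - r w with w = A(t) U(t,s) y, the mean value inequality gives
    the derivative of U(., s) y (propagator_diff). Finally, if V is another
    evolution system then r |-> U(t,r) V(r,s) y has vanishing forward derivative,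
    whence V = U (evolution_unique). *)

(** * The real-valued norm and the mean value inequality *)

Section RealNorm.
Variables (R : realType) (X : normedModType R[i]).
Implicit Types (x y z : X) (r e : R).

(** The norm takes values in R[i] but is nonnegative, so its real part carries
    all the information and can be handled by real arithmetic. *)
Definition rnorm x : R := complex.Re `|x|.

Lemma rnormE x : `|x| = (rnorm x)%:C.
Proof. by rewrite /rnorm RRe_real // ger0_real. Qed.

Lemma rnorm_ge0 x : 0 <= rnorm x.
Proof. by rewrite -ler0c -rnormE. Qed.

Lemma rnorm0 : rnorm 0 = 0.
Proof. by rewrite /rnorm normr0. Qed.

Lemma rnorm0_eq0 x : rnorm x = 0 -> x = 0.
Proof. by move=> x0; apply/normr0_eq0; rewrite rnormE x0. Qed.

Lemma rnormN x : rnorm (- x) = rnorm x.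
Proof. by rewrite /rnorm normrN. Qed.

Lemma rnormB x y : rnorm (x - y) = rnorm (y - x).
Proof. by rewrite -rnormN opprB. Qed.

Lemma rnormD x y : rnorm (x + y) <= rnorm x + rnorm y.
Proof. by rewrite -lecR rmorphD /= -!rnormE ler_normD. Qed.

Lemma rnorm_tri z x y : rnorm (x - y) <= rnorm (x - z) + rnorm (z - y).
Proof. by rewrite -[x - y](subrKA z) rnormD. Qed.

Lemma subr_interchange x y z w : (x - y) - (z - w) = (x - z) - (y - w) :> X.
Proof. by rewrite !opprB addrACA [RHS]addrACA [- y - z]addrC. Qed.

Lemma rnormB2 x y z w : rnorm ((x - y) - (z - w)) <= rnorm (x - z) + rnorm (y - w).
Proof. by rewrite subr_interchange -(rnormN (y - w)) rnormD. Qed.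

(** Meant for two curves: u and v are the first-order parts of their increments
    x - z and y - w. *)
Lemma rnormB3 x y z w u v : rnorm ((x - y) - (z - w)) <=
  rnorm (x - z - u) + rnorm (y - w - v) + rnorm (u - v).
Proof.
rewrite subr_interchange -[X in rnorm X <= _](subrK (u - v)).
rewrite (subr_interchange (x - z) (y - w) u v).
apply: le_trans (rnormD _ _) _; rewrite lerD2r.
by apply: le_trans (rnormD _ _) _; rewrite rnormN.
Qed.

Lemma rnormZ (c : R[i]) x : rnorm (c *: x) = complex.Re `|c| * rnorm x.
Proof.
have cE : `|c| = (complex.Re `|c|)%:C by rewrite RRe_real // ger0_real.
move: (complex.Re _) cE => r cE.
by apply: complexI; rewrite -rnormE normrZ cE rnormE -rmorphM.
Qed.

Lemma rnormZr r x : rnorm (r%:C *: x) = `|r| * rnorm x.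
Proof. by rewrite rnormZ normc_def /= expr0n /= addr0 sqrtr_sqr. Qed.

Lemma rnorm_sum n (f : 'I_n -> X) :
  rnorm (\sum_(i < n) f i) <= \sum_(i < n) rnorm (f i).
Proof.
elim/big_ind2: _ => [|x1 r1 x2 r2 h1 h2|//]; first by rewrite rnorm0.
exact: le_trans (rnormD _ _) (lerD h1 h2).
Qed.

Lemma rnorm_le_all r x y : (forall e, 0 < e -> rnorm (x - y) <= r * e) -> x = y.
Proof.
move=> h; apply/subr0_eq/rnorm0_eq0/eqP; rewrite eq_le rnorm_ge0 andbT.
have r0 : 0 <= r by have := h 1 ltr01; rewrite mulr1; apply: le_trans (rnorm_ge0 _).
apply/ler_addgt0Pr => e e0; rewrite add0r.
have := h (e / (r + 1)); rewrite divr_gt0 ?ltr_wpDl// => /(_ isT)/le_trans; apply.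
rewrite mulrA ler_pdivrMr ?ltr_wpDl//; nra.
Qed.

Lemma rnorm_cvgP T (F : set_system T) {FF : Filter F} (f : T -> X) (l : X) :
  f @ F --> l <-> forall e, 0 < e -> \forall t \near F, rnorm (l - f t) <= e.
Proof.
split=> [/cvgrPdist_le h e e0|h].
  have := h e%:C; rewrite ltcR => /(_ e0).
  by apply: filterS => t; rewrite rnormE lecR.
apply/cvgrPdist_le => e e0.
have er : (complex.Re e)%:C = e by rewrite RRe_real // gtr0_real.
have /h : 0 < complex.Re e by rewrite -ltcR er.
by apply: filterS => t; rewrite rnormE -er lecR.
Qed.

Lemma rnorm_cvg_le_near (u : nat -> X) (v : X) (K : R) N :
  u n @[n --> \oo] --> v -> (forall n, (N <= n)%N -> rnorm (u n) <= K) -> rnorm v <= K.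
Proof.
move=> /rnorm_cvgP uv uK; apply/ler_addgt0Pr => e e0.
have [N' _ hN'] := uv e e0; have := hN' (maxn N N') (leq_maxr _ _).
have := rnorm_tri (u (maxn N N')) v 0; rewrite !subr0.
have := uK (maxn N N') (leq_maxl _ _); lra.
Qed.

Lemma rnorm_cvg_le (u : nat -> X) (v : X) (K : R) :
  u n @[n --> \oo] --> v -> (forall n, rnorm (u n) <= K) -> rnorm v <= K.
Proof. by move=> uv uK; apply: (@rnorm_cvg_le_near u v K 0). Qed.

Lemma within_continuousP (T : pseudoMetricType R) (D : set T) (f : T -> X) :
  {within D, continuous f} <->
  forall t, D t -> forall e, 0 < e -> exists2 d, 0 < d &
    forall s, D s -> ball t d s -> rnorm (f t - f s) <= e.
Proof.
split=> [/subspace_continuousP h t Dt e e0|h].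
  have /rnorm_cvgP/(_ e e0) := h t Dt.
  rewrite /prop_near1 /within /= => /nbhs_ballP[d /= d0 hd].
  by exists d => // s Ds ts; apply: hd.
apply/subspace_continuousP => t Dt.
apply/rnorm_cvgP => e e0; have [d d0 hd] := h t Dt e e0.
rewrite /prop_near1 /within /=; apply/nbhs_ballP; exists d => //= s ts Ds.
exact: hd.
Qed.

Lemma denseP (S : set X) : dense S ->
  forall x e, 0 < e -> exists2 y, S y & rnorm (x - y) <= e.
Proof.
move=> dS x e e0.
have [y [xy Sy]] : (ball x e%:C) `&` S !=set0.
  apply: dS; first by exists x; apply: ballxx; rewrite ltcR.
  exact: ball_open.
exists y => //; move: xy; rewrite -ball_normE /ball_ /= rnormE ltcR.
exact: ltW.
Qed.

(** For every e > 0, the set of t for which the bound with slope K + e holds on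
    all of [a, t] contains its supremum by left continuity, and the estimate on
    forward increments does not let the supremum be smaller than b. Backward
    increments are not controlled because the product approximations have a
    generator that jumps at the partition points. *)
Lemma mean_value (f : R -> X) (a b K : R) : a <= b ->
  (forall t, a < t -> t <= b -> forall e, 0 < e -> exists2 d, 0 < d &
     forall s, a <= s -> s < t -> t - s < d -> rnorm (f t - f s) <= e) ->
  (forall t, a <= t -> t < b -> forall e, 0 < e -> exists2 d, 0 < d &
     forall h, 0 < h -> h < d -> t + h <= b ->
       rnorm (f (t + h) - f t) <= (K + e) * h) ->
  rnorm (f b - f a) <= K * (b - a).
Proof.
move=> ab fl fr.
apply/ler_addgt0Pr => e0 e0_gt0.
pose e := e0 / (b - a + 1).
have ba1 : 0 < b - a + 1 by lra.
have e_gt0 : 0 < e by rewrite divr_gt0.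
have ee : e * (b - a) <= e0.
  by rewrite /e mulrAC ler_pdivrMr //; nra.
(* The bound is required on all of [a, t] so that it is available to the left of
   the supremum. *)
pose S : set R := [set t | a <= t <= b /\
  forall s, a <= s <= t -> rnorm (f s - f a) <= (K + e) * (s - a)].
have Sa : S a.
  split; first by rewrite lexx.
  move=> s sa; have -> : s = a by apply/eqP; rewrite eq_le andbC.
  by rewrite !subrr rnorm0 mulr0.
have supS : has_sup S by split; [exists a | exists b => t [/andP[]]].
set c := sup S.
have ac : a <= c by apply: ub_le_sup => //; case: supS.
have cb : c <= b by apply: ge_sup; [case: supS | move=> t [/andP[]]].
have below s : a <= s -> s < c -> rnorm (f s - f a) <= (K + e) * (s - a).
  move=> as_ sc;
  have cs0 : 0 < c - s by lra.
  have [t [tab h] st] := sup_adherent cs0 supS.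
  by apply: h; rewrite as_ /= ltW //; move: st; rewrite opprB addrC subrK.
suff Sc : S c.
  have -> : b = c.
    apply/eqP; rewrite eq_le cb andbT leNgt; apply/negP => cltb.
    have [d d0 hd] := fr c ac cltb e e_gt0.
    (* A step that is short enough for the increment estimate and stays below b. *)
    pose h0 := Num.min (d / 2) (b - c).
    have h00 : 0 < h0 by rewrite lt_min; apply/andP; split; lra.
    have h0d : h0 < d by rewrite gt_min; apply/orP; left; lra.
    have h0b : h0 <= b - c by rewrite ge_min lexx orbT.
    suff /(ub_le_sup _) : S (c + h0).
      by have [_ ub] := supS => /(_ ub); rewrite -/c; lra.
    split; first by lra.
    move=> s /andP[as_ sch].
    have [sc|cs] := leP s c.
      by apply: Sc.2; rewrite as_.
    have hsc := Sc.2 c; rewrite ac lexx in hsc; have {}hsc := hsc isT.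
    have := hd (s - c); rewrite [c + (s - c)]addrC subrK => hs.
    have {}hs : rnorm (f s - f c) <= (K + e) * (s - c) by apply: hs; lra.
    have := rnorm_tri (f c) (f s) (f a); nra.
  have := Sc.2 c; rewrite ac lexx => /(_ isT); rewrite mulrDl.
  have : e * (c - a) <= e * (b - a) by apply: ler_wpM2l; lra.
  by move: ee; lra.
split; first by rewrite ac.
move=> s /andP[as_ sc].
have [{}sc|cs] := ltP s c; first exact: below.
have -> : s = c by apply/eqP; rewrite eq_le sc.
have [->|ca] := eqVneq c a; first by rewrite !subrr rnorm0 mulr0.
have {}ca : a < c by rewrite lt_neqAle eq_sym ca.
apply/ler_addgt0Pr => e1 e1_gt0.
have [d d0 hd] := fl c ca cb (e1/2) ltac:(lra).
pose D := `|K + e| + 1.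
have D0 : 0 < D by rewrite ltr_wpDl.
have De : 0 < e1 / 2 / D by rewrite !divr_gt0.
pose h := Num.min (d / 2) (Num.min (c - a) (e1 / 2 / D)).
have h0 : 0 < h by rewrite !lt_min; apply/and3P; split => //; lra.
have hhd : h < d by rewrite gt_min; apply/orP; left; lra.
have hca : h <= c - a by rewrite !ge_min lexx orbT.
have hD : h <= e1 / 2 / D by rewrite !ge_min lexx !orbT.
have h1 := below (c - h) ltac:(lra) ltac:(lra).
have h2 := hd (c - h) ltac:(lra) ltac:(lra) ltac:(lra).
have h3 : h * D <= e1 / 2 by rewrite -ler_pdivlMr.
have := rnorm_tri (f (c - h)) (f c) (f a).
have h4 : - ((K + e) * h) <= h * D.
  have : - (K + e) <= D by rewrite /D; have := ler_norm (- (K + e)); rewrite normrN; lra.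
  by move=> /(ler_wpM2r (ltW h0)); lra.
by move: h1 h2 h3 h4; lra.
Qed.

Lemma mean_value_lip (f : R -> X) (a b K L : R) : a <= b -> 0 <= L ->
  (forall s t, a <= s -> s <= t -> t <= b -> rnorm (f t - f s) <= L * (t - s)) ->
  (forall t, a <= t -> t < b -> forall e, 0 < e -> exists2 d, 0 < d &
     forall h, 0 < h -> h < d -> t + h <= b ->
       rnorm (f (t + h) - f t) <= (K + e) * h) ->
  rnorm (f b - f a) <= K * (b - a).
Proof.
move=> ab L0 fL fr; apply: mean_value => // t at_ tb e e0.
exists (e / (L + 1)); first by rewrite divr_gt0 // ltr_wpDl.
move=> s as_ st std; apply: le_trans (fL _ _ as_ (ltW st) tb) _.
by move: std; rewrite ltr_pdivlMr ?ltr_wpDl //; nra.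
Qed.

End RealNorm.

(** Pointwise limits exist by completeness; letting one of the two indices of the
    Cauchy estimate tend to infinity keeps the bound uniform on D. *)
Lemma uniform_limit (R : realType) (X : completeNormedModType R[i]) (T : Type)
    (D : T -> Prop) (f : nat -> T -> X) :
  (forall e, 0 < e -> exists N, forall n m t, (N <= n)%N -> (N <= m)%N -> D t ->
     rnorm (f n t - f m t) <= e) ->
  forall e, 0 < e -> exists N, forall n t, (N <= n)%N -> D t ->
     rnorm (lim (f k t @[k --> \oo]) - f n t) <= e.
Proof.
move=> fC.
have fcv t : D t -> f k t @[k --> \oo] --> lim (f k t @[k --> \oo]).
  move=> Dt; apply: cauchy_cvg; apply/cauchy_exP => e e0.
  have er : (complex.Re e)%:C = e by rewrite RRe_real // gtr0_real.
  have r0 : 0 < complex.Re e by rewrite -ltcR er.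
  have e'0 : 0 < complex.Re e / 2 by rewrite divr_gt0.
  have [N hN] := fC _ e'0.
  exists (f N t), N => // n /= Nn; rewrite -ball_normE /ball_ /= rnormE -er ltcR.
  by apply: le_lt_trans (hN N n t (leqnn N) Nn Dt) _; lra.
move=> e e0; have e20 : 0 < e / 2 by lra.
have [N hN] := fC _ e20; exists N => n t Nn Dt.
have /rnorm_cvgP/(_ _ e20) [N' _ hN'] := fcv t Dt.
have := hN' (maxn N N') (leq_maxr _ _).
have := hN (maxn N N') n t (leq_maxl _ _) Nn Dt.
have := rnorm_tri (f (maxn N N') t) (lim (f k t @[k --> \oo])) (f n t).
by lra.
Qed.

(** * Elementary inequalities *)

(** Absorbs the quadratic remainders u and v of two first-order expansions into an
    arbitrarily small multiple of h. *)
Lemma quadratic_error_bound (R : realType) (c e e' h u v x y z : R) : 0 <= c -> 0 < h ->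
  h < e' / (2 * c + 1) -> u <= c * h ^+ 2 -> v <= c * h ^+ 2 ->
  x <= e / 2 -> y <= e / 2 -> z <= x + y ->
  u + v + h * z <= (e + e') * h.
Proof.
move=> c0 h0; rewrite ltr_pdivlMr; last by lra.
move=> he hu hv hx hy hz.
have h1 : h * z <= h * e by apply: ler_wpM2l; lra.
have h2 : (h * (2 * c + 1)) * h <= e' * h by apply: ler_wpM2r; lra.
by move: h2; rewrite expr2 in hu hv; nra.
Qed.

(** The slope e survives the two factors S lost to stable products and the factor T
    lost to the coefficients, because it was divided by S * (S * T) beforehand. *)
Lemma stable_increment_bound (R : realType) (S T e e' h u v q x : R) :
  0 < S -> 0 < T -> 0 < h ->
  u <= e' / S / 2 * h -> v <= e' / S / 2 * h -> q <= S * (e / (S * (S * T)) * T) ->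
  x <= u + v + h * q -> S * x <= (e + e') * h.
Proof.
move=> S0 T0 h0 hu hv hq hx.
have eT : S * (S * (e / (S * (S * T)) * T)) = e by field; rewrite !gt_eqF.
have eS : S * (e' / S / 2 * h) = e' / 2 * h by field; rewrite gt_eqF.
have h1 : S * x <= S * (u + v + h * q) by rewrite ler_pM2l.
have h2 : h * (S * q) <= h * e.
  by rewrite -[X in _ <= _ * X]eT; apply: ler_wpM2l; [exact: ltW | rewrite ler_pM2l].
have h3 : S * u <= e' / 2 * h by rewrite -eS ler_pM2l.
have h4 : S * v <= e' / 2 * h by rewrite -eS ler_pM2l.
lra.
Qed.

(** Two time pairs are compared through (max t t', min s s'), so that all
    intermediate pairs stay ordered; the detours add up to the distances. *)
Lemma ordered_detour_bound (R : realType) (L1 L2 s s' t t' : R) : 0 <= L1 -> 0 <= L2 ->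
  L1 * (Num.max t t' - t) + L2 * (s - Num.min s s') +
  (L1 * (Num.max t t' - t') + L2 * (s' - Num.min s s')) <=
  (L1 + L2) * (`|t - t'| + `|s - s'|).
Proof.
move=> L10 L20.
have -> : `|t - t'| = (Num.max t t' - t) + (Num.max t t' - t').
  have [h|h] := leP t t'; first by rewrite ler0_norm ?subr_le0 //; ring.
  by rewrite gtr0_norm ?subr_gt0 //; ring.
have -> : `|s - s'| = (s - Num.min s s') + (s' - Num.min s s').
  have [h|h] := leP s s'; first by rewrite ler0_norm ?subr_le0 //; ring.
  by rewrite gtr0_norm ?subr_gt0 //; ring.
have : 0 <= Num.max t t' - t by rewrite subr_ge0 le_max lexx.
have : 0 <= Num.max t t' - t' by rewrite subr_ge0 le_max lexx orbT.
have : 0 <= s - Num.min s s' by rewrite subr_ge0 ge_min lexx.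
have : 0 <= s' - Num.min s s' by rewrite subr_ge0 ge_min lexx orbT.
move: (_ - t) (_ - t') (s - _) (s' - _) => a b c d; nra.
Qed.

(** A Lipschitz estimate z for a good approximation of a vector, together with the
    two approximation errors x and y, controls the vector itself. *)
Lemma approximation_bound (R : realType) (L e a b x y z u v w : R) : 0 <= L ->
  0 <= a -> 0 <= b -> a < e / 4 / (L + 1) -> b < e / 4 / (L + 1) ->
  x <= e / 4 -> y <= e / 4 ->
  z <= L * (a + b) -> u <= x + v -> v <= z + w -> w = y -> u <= e.
Proof.
move=> L0 a0 b0; rewrite !ltr_pdivlMr ?ltr_wpDl // => ha hb hx hy hz hu hv hw.
have : L * (a + b) <= e / 2 by nra.
lra.
Qed.

(** * Products over the cells of a uniform partition *)

Section Cells.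
Variables (R : realType) (n : nat).
Implicit Types (r s t : R) (i m : nat).

Definition node i : R := i%:R / n.+1%:R.

Definition mesh : R := n.+1%:R^-1.

(** Length of the part of the i-th cell that lies to the left of t. *)
Definition clamp i t : R := Num.min (Num.max t (node i)) (node i.+1) - node i.

(** Length of the intersection of the i-th cell with [s, t]. *)
Definition overlap i t s : R := clamp i t - clamp i s.

Lemma node0 : node 0 = 0.
Proof. by rewrite /node mul0r. Qed.

Lemma nodeS i : node i.+1 = node i + mesh.
Proof. by rewrite /node -[i.+1]addn1 natrD mulrDl mul1r. Qed.

Lemma node_last : node n.+1 = 1.
Proof. by rewrite /node divff ?pnatr_eq0. Qed.

Lemma mesh_gt0 : 0 < mesh.
Proof. by rewrite invr_gt0 ltr0n. Qed.

Lemma le_node i j : (i <= j)%N -> node i <= node j.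
Proof. by move=> ij; rewrite /node ler_wpM2r ?ler_nat // ltW // mesh_gt0. Qed.

Lemma node_unitI i : (i <= n)%N -> unitI (node i).
Proof.
move=> ni; rewrite /unitI /= -node0 le_node //= -node_last le_node //.
exact: ltnW.
Qed.

Lemma clamp_cases i t :
  [\/ t <= node i /\ clamp i t = 0,
      [/\ node i <= t, t <= node i.+1 & clamp i t = t - node i]
    | node i.+1 <= t /\ clamp i t = mesh].
Proof.
have := mesh_gt0; rewrite /clamp nodeS => m0.
have [ti|it] := leP t (node i).
  by constructor 1; split => //; rewrite min_l ?subrr //; lra.
have [ti|it'] := leP t (node i + mesh).
  by constructor 2; rewrite (ltW it).
by constructor 3; rewrite addrAC subrr add0r ltW.
Qed.

Lemma overlap_refl i t : overlap i t t = 0.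
Proof. exact: subrr. Qed.

Lemma overlap_bounds i t s : s <= t -> 0 <= overlap i t s <= mesh.
Proof.
have := mesh_gt0; rewrite /overlap => m0 st; apply/andP.
case: (clamp_cases i t) => [[]|[]|[]]; case: (clamp_cases i s) => [[]|[]|[]];
  rewrite ?nodeS; lra.
Qed.

Lemma overlap_ge0 i t s : s <= t -> 0 <= overlap i t s.
Proof. by move=> /(overlap_bounds i) /andP[]. Qed.

Lemma overlapD i t s r : overlap i t s + overlap i s r = overlap i t r.
Proof. by rewrite /overlap; lra. Qed.

Lemma overlap_below i t s : s <= t -> t <= node i -> overlap i t s = 0.
Proof.
have := mesh_gt0; rewrite /overlap => m0 st ti.
case: (clamp_cases i t) => [[]|[]|[]]; case: (clamp_cases i s) => [[]|[]|[]];
  rewrite ?nodeS; lra.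
Qed.

Lemma overlap_above i t s : s <= t -> node i.+1 <= s -> overlap i t s = 0.
Proof.
have := mesh_gt0; rewrite /overlap nodeS => m0 st ti.
case: (clamp_cases i t) => [[]|[]|[]]; case: (clamp_cases i s) => [[]|[]|[]];
  rewrite ?nodeS; lra.
Qed.

Lemma overlap_inside i t s : node i <= s -> s <= t -> t <= node i.+1 ->
  overlap i t s = t - s.
Proof.
have := mesh_gt0; rewrite /overlap nodeS => m0 si st ti.
case: (clamp_cases i t) => [[]|[]|[]]; case: (clamp_cases i s) => [[]|[]|[]];
  rewrite ?nodeS; lra.
Qed.

Lemma sum_overlap_le1 t s : s <= t -> \sum_(i < n.+1) overlap i t s <= 1.
Proof.
move=> st; have -> : 1 = \sum_(i < n.+1) mesh.
  by rewrite sumr_const card_ord -mulr_natl /mesh divff ?pnatr_eq0.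
by apply: ler_sum => i _; have /andP[] := overlap_bounds i st.
Qed.

(** Advancing from s to t one cell at a time. The induction runs over the time
    reached so far, hence P can speak about the product formed up to that time. *)
Lemma cell_ind (P : R -> Prop) s t : 0 <= s -> s <= t -> t <= 1 -> P s ->
  (forall i r r', (i <= n)%N -> s <= r -> node i <= r -> r <= r' ->
     r' <= node i.+1 -> r' <= t -> P r -> P r') ->
  P t.
Proof.
move=> s0 st t1 Ps PS.
suff prefix m : (m <= n.+1)%N -> forall r, s <= r -> r <= t -> r <= node m -> P r.
  by apply: (prefix n.+1); rewrite ?node_last.
elim: m => [_ r sr rt|m IH mn r sr rt rm].
  by rewrite node0 => r0; have -> : r = s by lra.
have [rm'|mr] := leP r (node m); first exact: IH (ltnW mn) _ _ _ _.
have [sm|ms] := leP s (node m).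
  apply: (PS m (node m)) => //; first exact: ltW.
  by apply: IH (ltnW mn) _ _ _ _ => //; apply: le_trans (ltW mr) rt.
by apply: (PS m s) => //; apply: ltW.
Qed.

Lemma locate t : 0 <= t -> t < 1 ->
  exists2 i, (i <= n)%N & node i <= t < node i.+1.
Proof.
move=> t0 t1; have n0 : 0 < n.+1%:R :> R by rewrite ltr0n.
have := @truncn_itv R (t * n.+1%:R) (mulr_ge0 t0 (ltW n0)).
set i := Num.truncn _ => /andP[h1 h2]; exists i.
  rewrite -ltnS -(ltr_nat R); apply: le_lt_trans h1 _.
  by rewrite -[ltRHS]mul1r ltr_pM2r.
by rewrite /node ler_pdivrMr // ltr_pdivlMr // h1.
Qed.

Section Product.
Variables (Z : Type) (T : nat -> R -> Z -> Z).
Implicit Type z : Z.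

(** With T i the semigroup of the generator frozen at node i, this is the product
    approximation; with T i a Taylor map, it transports coefficient families. One
    definition serves both, so that they split in the same way. *)
Fixpoint cell_prod m t s z : Z :=
  if m is m'.+1 then T m' (overlap m' t s) (cell_prod m' t s z) else z.

Definition evol t s z : Z := cell_prod n.+1 t s z.

Hypothesis T0 : forall i z, (i <= n)%N -> T i 0 z = z.
Hypothesis TD : forall i g h z, (i <= n)%N -> 0 <= g -> 0 <= h ->
  T i (g + h) z = T i g (T i h z).

Lemma cell_prod_id m t s z : (m <= n.+1)%N ->
  (forall i, (i < m)%N -> overlap i t s = 0) -> cell_prod m t s z = z.
Proof.
elim: m => //= m IH mn h; rewrite h // T0 //; apply: IH => [|i im].
  exact: ltnW.
by apply: h; apply: ltnW.
Qed.

Lemma evol_refl t z : evol t t z = z.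
Proof. by apply: cell_prod_id => // i _; exact: overlap_refl. Qed.

(** The point s splits at most one cell, where the semigroup law glues the two
    factors; each of the remaining cells is trivial in one of the two products. *)
Lemma evol_trans t s r z : r <= s -> s <= t ->
  evol t s (evol s r z) = evol t r z.
Proof.
move=> rs st; rewrite /evol.
suff prefix m : (m <= n.+1)%N ->
  cell_prod m t s (cell_prod m s r z) = cell_prod m t r z by exact: prefix.
elim: m => //= m IH mn.
have [sm|ms] := leP s (node m).
  rewrite (overlap_below rs sm) T0 // IH ?(ltnW mn) //.
  by rewrite -(overlapD m t s r) (overlap_below rs sm) addr0.
have idm : forall z', cell_prod m t s z' = z'.
  move=> z'; apply: cell_prod_id; first exact: ltnW.
  by move=> i im; apply: overlap_above => //; apply: le_trans (le_node im) (ltW ms).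
rewrite -(overlapD m t s r).
by rewrite (@TD m (overlap m t s) (overlap m s r)) ?overlap_ge0 // -(IH (ltnW mn)) !idm.
Qed.

Lemma evol_local i t s z : (i <= n)%N -> node i <= s -> s <= t ->
  t <= node i.+1 -> evol t s z = T i (t - s) z.
Proof.
move=> ni is_ st ti; rewrite /evol -(overlap_inside is_ st ti).
suff prefix m : (i < m)%N -> (m <= n.+1)%N ->
  cell_prod m t s z = T i (overlap i t s) z by exact: prefix.
elim: m => // m IH; rewrite ltnS leq_eqVlt => /orP[/eqP <-|im] mn /=.
  rewrite cell_prod_id ?(ltnW mn) // => j ji.
  by apply: overlap_above => //; apply: le_trans (le_node ji) is_.
rewrite IH ?(ltnW mn) // (@overlap_below m) ?T0 //.
exact: le_trans ti (le_node im).
Qed.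

End Product.
End Cells.

(** * Taylor sums of coefficient families *)

Section Taylor.
Variables (R : realType) (X : normedModType R[i]) (p : nat).
Implicit Types (a g h K e : R) (l : seq R) (H : seq R -> X) (i j m : nat).

Definition tcoef h j : R := h ^+ j / j`!%:R.

(** The operator exp(h N_a), where (N_a H)(l) = H(l, a) shifts families indexed by
    lists of length at most p+1. On longer lists the truncated subtraction leaves
    the single term j = 0, which makes exp(0) = id and the semigroup law hold for
    every family. *)
Definition taylor a h H l : X :=
  \sum_(j < (p.+1 - size l).+1) (tcoef h j)%:C *: H (l ++ nseq j a).

Lemma tcoef0 h : tcoef h 0 = 1.
Proof. by rewrite /tcoef expr0 fact0 divr1. Qed.

Lemma tcoef1 h : tcoef h 1 = h.
Proof. by rewrite /tcoef expr1 divr1. Qed.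

Lemma tcoef0S j : tcoef 0 j.+1 = 0.
Proof. by rewrite /tcoef expr0n mul0r. Qed.

Lemma tcoef_ge0 h j : 0 <= h -> 0 <= tcoef h j.
Proof. by move=> h0; rewrite divr_ge0 ?exprn_ge0. Qed.

Lemma tcoef_le h i j : 0 <= h -> h <= 1 -> (i <= j)%N -> tcoef h j <= h ^+ i.
Proof.
move=> h0 h1 ij; rewrite /tcoef ler_pdivrMr ?ltr0n ?fact_gt0 //.
rewrite -{1}(subnKC ij) exprD ler_wpM2l ?exprn_ge0 //.
apply: (@le_trans _ _ 1); first by rewrite exprn_ile1.
by rewrite ler1n fact_gt0.
Qed.

Lemma tcoefD g h m :
  tcoef (g + h) m = \sum_(j < m.+1) tcoef g j * tcoef h (m - j).
Proof.
rewrite /tcoef addrC exprDn mulr_suml; apply: eq_bigr => j _.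
have jm : (j <= m)%N by rewrite -ltnS.
have fN0 k : k`!%:R != 0 :> R by rewrite pnatr_eq0 -lt0n fact_gt0.
rewrite -[_ *+ 'C(m, j)]mulr_natl -(bin_fact jm) !natrM.
have := fN0 j; have := fN0 (m - j)%N.
have : 'C(m, j)%:R != 0 :> R by rewrite pnatr_eq0 -lt0n bin_gt0.
by move=> c0 f0 f1; field; rewrite c0 f0 f1.
Qed.

Lemma triangular_sum (V : nmodType) (f : nat -> nat -> V) q :
  \sum_(j < q.+1) \sum_(i < (q - j).+1) f j i =
  \sum_(m < q.+1) \sum_(j < m.+1) f j (m - j)%N.
Proof.
elim: q => [|q IH]; first by rewrite !big_ord1.
rewrite [RHS]big_ord_recr /= -IH big_ord_recr [X in _ = _ + X]big_ord_recr /=.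
rewrite subnn big_ord1 addrA; congr (_ + _); rewrite -big_split /=.
by apply: eq_bigr => j _; rewrite subSn -1?ltnS // big_ord_recr.
Qed.

Lemma taylor0 a H : taylor a 0 H = H.
Proof.
apply/funext => l; rewrite /taylor big_ord_recl /= tcoef0 scale1r cats0.
by rewrite big1 ?addr0 // => j _; rewrite tcoef0S scale0r.
Qed.

(** exp(g N) exp(h N) = exp((g + h) N) by the binomial theorem; both sides are cut
    off at the same total number of appended nodes. *)
Lemma taylorD a g h H : taylor a (g + h) H = taylor a g (taylor a h H).
Proof.
apply/funext => l; rewrite /taylor.
under [RHS]eq_bigr => j _.
  rewrite size_cat size_nseq subnDA scaler_sumr.
  under eq_bigr => i _ do rewrite scalerA -rmorphM -catA -nseqD.
  over.
rewrite (triangular_sum (fun j i =>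
  (tcoef g j * tcoef h i)%:C *: H (l ++ nseq (j + i) a))).
apply: eq_bigr => m _; rewrite tcoefD rmorph_sum scaler_suml.
by apply: eq_bigr => j _; rewrite subnKC // -ltnS.
Qed.

(** For h <= 1 the weights with j > 0 are at most h, so their sum is at most
    1 + (p+1) h <= exp((p+1) h). The exponential form multiplies correctly when
    the estimate is iterated over cells. *)
Lemma taylor_dist a h e H H' l l' : 0 <= h -> h <= 1 -> size l = size l' ->
  (forall j, (size l + j <= p.+1)%N || (j == 0)%N ->
     rnorm (H (l ++ nseq j a) - H' (l' ++ nseq j a)) <= e) ->
  rnorm (taylor a h H l - taylor a h H' l') <= e * expR (p.+1%:R * h).
Proof.
move=> h0 h1 ll' hH; rewrite /taylor -ll' -sumrB.
have e0 : 0 <= e by apply: le_trans (rnorm_ge0 _) (hH 0%N _); rewrite orbT.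
set q := (p.+1 - size l)%N.
apply: (@le_trans _ _ (\sum_(j < q.+1) tcoef h j * e)).
  apply: le_trans (rnorm_sum _) _; apply: ler_sum => j _.
  rewrite -scalerBr rnormZr ger0_norm ?tcoef_ge0 // ler_wpM2l ?tcoef_ge0 //.
  apply: hH; case: j => -[|j] /=; rewrite ?orbT // orbF /q => jq; lia.
rewrite -mulr_suml mulrC ler_wpM2l //.
apply: le_trans (expR_ge1Dx _).
rewrite big_ord_recl tcoef0 lerD2l.
apply: (@le_trans _ _ (\sum_(i < q) h)).
  by apply: ler_sum => i _; have := @tcoef_le h 1 (bump 0 i) h0 h1 isT; rewrite expr1.
rewrite sumr_const card_ord -[h *+ q]mulr_natl ler_wpM2r // ler_nat.
by rewrite leq_subLR leq_addl.
Qed.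

Lemma taylor_bound a h K H l : 0 <= h -> h <= 1 ->
  (forall j, (size l + j <= p.+1)%N || (j == 0)%N ->
     rnorm (H (l ++ nseq j a)) <= K) ->
  rnorm (taylor a h H l) <= K * expR (p.+1%:R * h).
Proof.
move=> h0 h1 hH; rewrite -[taylor _ _ _ _]subr0.
have t0 : 0 = taylor a h (fun=> 0) l.
  by rewrite /taylor big1 // => j _; rewrite scaler0.
by rewrite [X in _ - X]t0; apply: taylor_dist => // j jp; rewrite subr0 hH.
Qed.

Lemma taylor_lip a h K H l : 0 <= h -> h <= 1 -> 0 <= K ->
  (forall j, (size l + j <= p.+1)%N -> rnorm (H (l ++ nseq j a)) <= K) ->
  rnorm (taylor a h H l - H l) <= p.+1%:R * K * h.
Proof.
move=> h0 h1 K0 hH; rewrite /taylor big_ord_recl tcoef0 scale1r cats0.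
rewrite addrC addKr; set q := (p.+1 - size l)%N.
apply: (@le_trans _ _ (\sum_(j < q) h * K)).
  apply: le_trans (rnorm_sum _) _; apply: ler_sum => j _.
  rewrite rnormZr ger0_norm ?tcoef_ge0 // ler_pM ?tcoef_ge0 ?rnorm_ge0 //.
    by have := @tcoef_le h 1 (bump 0 j) h0 h1 isT; rewrite expr1.
  apply: hH; have := ltn_ord j; rewrite {2}/q /= /bump /= => jq; lia.
rewrite sumr_const card_ord -[_ *+ q]mulr_natl [h * K]mulrC mulrA.
apply: ler_wpM2r => //; apply: ler_wpM2r => //; rewrite ler_nat.
by rewrite leq_subLR leq_addl.
Qed.

Lemma taylor_last a h H l : size l = p.+1 -> taylor a h H l = H l.
Proof.
by move=> lp; rewrite /taylor lp subnn big_ord1 tcoef0 scale1r cats0.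
Qed.

(** The shifted family H(l, a) is the derivative at h = 0; the remaining weights are
    at most h^2. *)
Lemma taylor_diff a h K H l : 0 <= h -> h <= 1 -> 0 <= K -> (size l <= p)%N ->
  (forall j, (size l + j <= p.+1)%N -> rnorm (H (l ++ nseq j a)) <= K) ->
  rnorm (taylor a h H l - H l - h%:C *: H (rcons l a)) <= p.+1%:R * K * h ^+ 2.
Proof.
move=> h0 h1 K0 lp hH; rewrite /taylor (subSn lp) 2!big_ord_recl tcoef0 scale1r cats0.
rewrite /= tcoef1 cats1 [_ + (_ + _)]addrC addrK [_ + \sum_(_ < _) _]addrC addrK.
set q := (p - size l)%N.
apply: (@le_trans _ _ (\sum_(j < q) h ^+ 2 * K)).
  apply: le_trans (rnorm_sum _) _; apply: ler_sum => j _.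
  rewrite rnormZr ger0_norm ?tcoef_ge0 // ler_pM ?tcoef_ge0 ?rnorm_ge0 //.
    exact: (@tcoef_le h 2 (bump 0 (bump 0 j))).
  apply: (hH (bump 0 (bump 0 j))); have := ltn_ord j; rewrite {2}/q /= /bump /= => jq; lia.
rewrite sumr_const card_ord -[_ *+ q]mulr_natl [h ^+ 2 * K]mulrC mulrA.
apply: ler_wpM2r; first exact: exprn_ge0.
apply: ler_wpM2r => //; rewrite ler_nat.
by rewrite leq_subLR (leq_trans (leqnSn p)) ?leq_addl.
Qed.

End Taylor.

(** * Uniform continuity on cubes *)

Section UniformContinuity.
Variables (R : realType) (X : normedModType R[i]).

Lemma cube_compact n : compact (@cube R n).
Proof.
apply: (@rV_compact R n (fun=> @unitI R)) => i.
rewrite (_ : @unitI R = `[0, 1]%classic); first exact: segment_compact.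
by apply/seteqP; split=> t; rewrite /= in_itv.
Qed.

Lemma cube_heine_cantor n (f : 'rV[R]_n -> X) : {within @cube R n, continuous f} ->
  forall e, 0 < e -> exists2 d, 0 < d & forall s s', cube s -> cube s' ->
    ball s d s' -> rnorm (f s - f s') <= e.
Proof.
move=> /within_continuousP fc e e0.
have /compact_near_coveringP/near_covering_withinP := @cube_compact n.
pose P (d : R) s := forall s', cube s' -> ball s d s' -> rnorm (f s - f s') <= e.
move=> /(_ _ (0 : R)^'+ P) /= H.
have /H : forall s, cube s -> \forall s' \near s & d \near (0:R)^'+, cube s' -> P d s'.
  move=> s cs; have [d d0 hd] := fc s cs (e / 2) ltac:(lra).
  have d20 : 0 < d / 2 by lra.
  exists (ball s (d / 2), [set r | 0 < r < d / 2]) => /=.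
    split; first exact: nbhsx_ballx.
    near=> r => /=; apply/andP; split; near: r; first exact: nbhs_right_gt.
    exact: nbhs_right_lt.
  move=> [s' r] /= [ss' /andP[r0 rd]] cs' s'' cs'' s's''.
  apply: le_trans (rnorm_tri (f s) _ _) _.
  have h1 : rnorm (f s - f s') <= e / 2.
    by apply: hd => //; apply: le_ball ss'; lra.
  have h2 : rnorm (f s - f s'') <= e / 2.
    apply: hd => //; rewrite [d]splitr; apply: ball_triangle ss' _.
    by apply: le_ball s's''; lra.
  by rewrite rnormB in h1; lra.
move=> h.
have [d [d0 hd]] : exists d, 0 < d /\ forall s, cube s -> P d s.
  near (0 : R)^'+ => d; exists d; split; near: d; first exact: nbhs_right_gt.
  exact: h.
by exists d => // s s' cs cs'; apply: hd.
Unshelve. all: by end_near. Qed.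

Lemma cube_bounded n (f : 'rV[R]_n -> X) : {within @cube R n, continuous f} ->
  exists K, forall s, cube s -> rnorm (f s) <= K.
Proof.
move=> /within_continuousP fc.
have /compact_near_coveringP/near_covering_withinP := @cube_compact n.
pose P (K : R) s := rnorm (f s) <= K.
move=> /(_ _ (pinfty_nbhs R) P) /= H.
have /H h : forall s, cube s -> \forall s' \near s & K \near +oo, cube s' -> P K s'.
  move=> s cs; have [d d0 hd] := fc s cs 1 ltr01.
  exists (ball s d, [set K | rnorm (f s) + 1 <= K]) => /=.
    by split; [exact: nbhsx_ballx | apply: nbhs_pinfty_ge; exact: num_real].
  move=> [s' K] /= [ss' hK] cs'; apply: le_trans hK.
  have := hd s' cs' ss'; have := rnorm_tri (f s) (f s') 0.
  by rewrite !subr0 rnormB; lra.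
near (pinfty_nbhs R) => K; exists K; near: K; exact: h.
Unshelve. all: by end_near. Qed.

End UniformContinuity.

(** * Coefficient families indexed by lists of parameters *)

Section Coefficients.
Variables (R : realType) (X : completeNormedModType R[i]) (p : nat).
Variables (C : forall k : nat, 'rV[R]_k.+1 -> operator X).
Variables (mu : 'rV[R]_p.+1 -> R[i]^o).
Implicit Types (l : seq R) (x y z : X) (a h : R).

Definition row_of n l : 'rV[R]_n := \row_(i < n) nth 0 l i.

(** All vectors C^(k)(s) y and, at the top level, mu(s) y as one family indexed by
    the list of parameters. Lists make the passage from C^(k)(s) to C^(k+1)(s, t)
    a mere concatenation, whereas rows change their type. *)
Definition coeff y l : X :=
  if (size l <= p)%N then C (row_of (size l).-1.+1 l) y
  else (mu (row_of p.+1 l) : R[i]) *: y.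

Definition admissible l : Prop :=
  [/\ (0 < size l)%N, (size l <= p.+1)%N & forall a, a \in l -> unitI a].

(** Since the lengths agree, the default value of nth at positions beyond the end is
    harmless. *)
Definition close (d : R) l l' : Prop :=
  size l = size l' /\ forall i, `|nth 0 l i - nth 0 l' i| < d.

Definition equicontinuous_at (H : seq R -> X) (d e : R) : Prop :=
  forall l l', admissible l -> admissible l' -> close d l l' ->
    rnorm (H l - H l') <= e.

Definition bounded_by (K : R) (H : seq R -> X) : Prop :=
  forall l, admissible l -> rnorm (H l) <= K.

Lemma coeffE k y l : size l = k.+1 -> (k < p)%N -> coeff y l = C (row_of k.+1 l) y.
Proof. by move=> lk kp; rewrite /coeff lk kp. Qed.

Lemma coeff_last y l : size l = p.+1 ->
  coeff y l = (mu (row_of p.+1 l) : R[i]) *: y.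
Proof. by move=> lp; rewrite /coeff lp ltnn. Qed.

Lemma cube_row_of n l : (forall a, a \in l -> unitI a) -> size l = n ->
  cube (row_of n l).
Proof. by move=> hl ln i; rewrite mxE; apply/hl/mem_nth; rewrite ln. Qed.

Definition seq_of n (s : 'rV[R]_n) : seq R := [seq s ord0 i | i <- enum 'I_n].

Lemma size_seq_of n (s : 'rV[R]_n) : size (seq_of s) = n.
Proof. by rewrite size_map size_enum_ord. Qed.

Lemma nth_seq_of n (s : 'rV[R]_n) (i : 'I_n) : nth 0 (seq_of s) i = s ord0 i.
Proof. by rewrite (nth_map i) ?size_enum_ord // nth_ord_enum. Qed.

Lemma seq_ofK n (s : 'rV[R]_n) : row_of n (seq_of s) = s.
Proof. by apply/rowP => i; rewrite mxE nth_seq_of. Qed.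

Lemma row_ofK n l : size l = n -> seq_of (row_of n l) = l.
Proof.
move=> ln; apply: (@eq_from_nth _ 0); rewrite size_seq_of // => i il.
by rewrite (nth_seq_of _ (Ordinal il)) mxE.
Qed.

Lemma seq_of_unitI n (s : 'rV[R]_n) : cube s -> forall a, a \in seq_of s -> unitI a.
Proof. by move=> cs a /mapP[i _ ->]. Qed.

Lemma row_of_pad n k l a : size l = k.+1 -> (k < n)%N ->
  pad n (row_of k.+1 l) a = row_of n (l ++ nseq (n - k.+1) a).
Proof.
move=> lk kn; apply/rowP => i; rewrite !mxE nth_cat lk ltnS.
have [ik|ki] := leqP i k; first by rewrite inordK.
by rewrite nth_nseq ltn_sub2r // (leq_ltn_trans ki).
Qed.

Lemma admissible_cat l a j : unitI a -> admissible l -> (size l + j <= p.+1)%N ->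
  admissible (l ++ nseq j a).
Proof.
move=> aI [l0 lp hl] ljp; split; rewrite ?size_cat ?size_nseq //.
  by rewrite addn_gt0 l0.
by move=> b; rewrite mem_cat => /orP[/hl//|/nseqP[-> _]].
Qed.

Lemma admissible_cat0 l a j : unitI a -> admissible l ->
  (size l + j <= p.+1)%N || (j == 0)%N -> admissible (l ++ nseq j a).
Proof.
move=> aI al; case: j => [|j]; first by rewrite cats0.
by rewrite orbF; exact: admissible_cat.
Qed.

Lemma close_cat d l l' a j : 0 < d -> close d l l' ->
  close d (l ++ nseq j a) (l' ++ nseq j a).
Proof.
move=> d0 [ll' h]; split; first by rewrite !size_cat ll'.
move=> i; rewrite !nth_cat -ll'; case: ifP => _; first exact: h.
by rewrite subrr normr0.
Qed.

Lemma close_row_of d n l l' : size l = n -> 0 < d -> close d l l' ->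
  ball (row_of n l) d (row_of n l').
Proof.
move=> ln d0 [ll' h]; split => // i j; rewrite !mxE /ball /=; exact: h.
Qed.

Lemma close_seq_of d n (s s' : 'rV[R]_n) : 0 < d -> ball s d s' ->
  close d (seq_of s) (seq_of s').
Proof.
move=> d0 [_ h]; split; first by rewrite !size_seq_of.
move=> i; have [ni|ni] := ltnP i n; last first.
  by rewrite !nth_default ?size_seq_of // subrr normr0.
by have := h ord0 (Ordinal ni); rewrite -!(nth_seq_of _ (Ordinal ni)).
Qed.

Definition in_domains y : Prop := forall k (s : 'rV[R]_k.+1),
  (k < p)%N -> cube s -> op_dom (C s) y.

Lemma max_cont_subspaceI y : in_domains y ->
  (forall e, 0 < e -> exists2 d, 0 < d & equicontinuous_at (coeff y) d e) ->
  max_cont_subspace p C y.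
Proof.
move=> yD yC k kp; split=> [s cs|]; first exact: yD.
apply/within_continuousP => s cs e e0; have [d d0 hd] := yC e e0.
exists d => // s' cs' ss'.
have := hd (seq_of s) (seq_of s').
rewrite !(@coeffE k) ?size_seq_of // !seq_ofK; apply.
- by split; rewrite ?size_seq_of //; [exact: ltnW | exact: seq_of_unitI].
- by split; rewrite ?size_seq_of //; [exact: ltnW | exact: seq_of_unitI].
- exact: close_seq_of.
Qed.

Lemma max_cont_subspace_dom y : max_cont_subspace p C y -> in_domains y.
Proof. by move=> yY k s kp cs; apply: (yY k kp).1. Qed.

Hypothesis mu_cont : {within @cube R p.+1, continuous mu}.

(** Heine-Cantor at each of the finitely many levels; the smallest of the resulting
    radii serves all levels at once. *)
Lemma max_cont_subspace_equi y : max_cont_subspace p C y ->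
  forall e, 0 < e -> exists2 d, 0 < d & equicontinuous_at (coeff y) d e.
Proof.
move=> yY e e0.
have level m : (m <= p)%N -> exists2 d, 0 < d & forall l l', size l = m.+1 ->
    admissible l -> admissible l' -> close d l l' -> rnorm (coeff y l - coeff y l') <= e.
  rewrite leq_eqVlt => /orP[/eqP ->|mp].
    have e'0 : 0 < e / (rnorm y + 1) by rewrite divr_gt0 // ltr_wpDl // rnorm_ge0.
    have [d d0 hd] := cube_heine_cantor mu_cont e'0.
    exists d => // l l' lp [_ _ hl] [_ _ hl'] ll'.
    have l'p : size l' = p.+1 by rewrite -ll'.1.
    rewrite !coeff_last // -scalerBl rnormZ.
    have := hd _ _ (cube_row_of hl lp) (cube_row_of hl' l'p) (close_row_of lp d0 ll').
    rewrite /rnorm => /(ler_wpM2r (rnorm_ge0 y)) /le_trans; apply.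
    rewrite mulrAC ler_pdivrMr ?ltr_wpDl ?rnorm_ge0 //.
    by have := rnorm_ge0 y; nra.
  have [d d0 hd] := cube_heine_cantor (yY m mp).2 e0.
  exists d => // l l' lm [_ _ hl] [_ _ hl'] ll'.
  have l'm : size l' = m.+1 by rewrite -ll'.1.
  rewrite !(@coeffE m) //; apply: hd; try exact: cube_row_of.
  exact: close_row_of.
have prefix q : (q <= p)%N -> exists2 d, 0 < d &
    forall m l l', (m <= q)%N -> size l = m.+1 -> admissible l -> admissible l' ->
      close d l l' -> rnorm (coeff y l - coeff y l') <= e.
  elim: q => [|q IH] qp.
    have [d d0 hd] := level 0%N isT; exists d => // m l l'.
    by rewrite leqn0 => /eqP ->; exact: hd.
  have [d d0 hd] := IH (ltnW qp); have [d' d'0 hd'] := level _ qp.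
  exists (Num.min d d'); first by rewrite lt_min d0.
  move=> m l l'; rewrite leq_eqVlt => /orP[/eqP ->|mq] lm al al' [ll' h].
    apply: hd' => //; split => // i; apply: lt_le_trans (h i) _.
    by rewrite ge_min lexx orbT.
  apply: (hd m) => //.
  by split => // i; apply: lt_le_trans (h i) _; rewrite ge_min lexx.
have [d d0 hd] := prefix p (leqnn p).
exists d => // l l' al al'; case: (al) => l0 lp _; apply: (hd (size l).-1) => //; lia.
Qed.

Lemma max_cont_subspace_bounded y : max_cont_subspace p C y ->
  exists2 K, 0 <= K & bounded_by K (coeff y).
Proof.
move=> yY.
have level m : (m <= p)%N -> exists K, forall l, size l = m.+1 ->
    admissible l -> rnorm (coeff y l) <= K.
  rewrite leq_eqVlt => /orP[/eqP ->|mp].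
    have [K hK] := cube_bounded mu_cont.
    exists (K * rnorm y) => l lp [_ _ hl].
    rewrite coeff_last // rnormZ ler_wpM2r ?rnorm_ge0 //.
    exact: hK (cube_row_of hl lp).
  have [K hK] := cube_bounded (yY m mp).2.
  exists K => l lm [_ _ hl]; rewrite (@coeffE m) //.
  exact/hK/cube_row_of.
have prefix q : (q <= p)%N -> exists K, forall m l, (m <= q)%N ->
    size l = m.+1 -> admissible l -> rnorm (coeff y l) <= K.
  elim: q => [|q IH] qp.
    by have [K hK] := level 0%N isT; exists K => m l; rewrite leqn0 => /eqP ->; exact: hK.
  have [K hK] := IH (ltnW qp); have [K' hK'] := level _ qp.
  exists (Num.max K K') => m l; rewrite leq_eqVlt => /orP[/eqP ->|mq] lm al.
    by rewrite le_max hK' // orbT.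
  by rewrite le_max (hK m).
have [K hK] := prefix p (leqnn p).
exists `|K| => // l al; apply: le_trans (ler_norm K).
by case: (al) => l0 lp _; apply: (hK (size l).-1) => //; lia.
Qed.

End Coefficients.

(** * Linear maps *)

Section Linear.
Variables (R : realType) (X : normedModType R[i]).

(** The algebraic half of bounded_operator, needed separately because bounds are
    tracked with explicit constants. *)
Definition linear_map (f : X -> X) : Prop :=
  forall (c : R[i]) x y, f (c *: x + y) = c *: f x + f y.

Variable f : X -> X.
Hypothesis f_lin : linear_map f.

Lemma linear_map0 : f 0 = 0.
Proof.
have := f_lin 1 0 0; rewrite !scale1r addr0 => /eqP.
by rewrite -subr_eq subrr => /eqP.
Qed.

Lemma linear_mapZ c x : f (c *: x) = c *: f x.
Proof. by have := f_lin c x 0; rewrite linear_map0 !addr0. Qed.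

Lemma linear_mapD x y : f (x + y) = f x + f y.
Proof. by have := f_lin 1 x y; rewrite !scale1r. Qed.

Lemma linear_mapB x y : f (x - y) = f x - f y.
Proof. by rewrite addrC -scaleN1r f_lin scaleN1r addrC. Qed.

Lemma linear_map_sum n (c : 'I_n -> R[i]) (x : 'I_n -> X) :
  f (\sum_(i < n) c i *: x i) = \sum_(i < n) c i *: f (x i).
Proof.
elim/big_ind2: _ => [|_ x1 _ x2 <- <-|i _]; first exact: linear_map0.
  exact: linear_mapD.
exact: linear_mapZ.
Qed.

End Linear.

(** * Product approximations and the commutation relation *)

Section Approximation.
Variables (R : realType) (X : completeNormedModType R[i]) (p : nat).
Hypothesis hp : (0 < p)%N.
Variables (A : R -> operator X) (E : R -> R -> X -> X).
Hypothesis hA : forall t : R, unitI t -> generates (A t) (E t).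
Variables (M omega : R).
Hypothesis hM : 1 <= M.
Hypothesis hstable : stable E M omega.
Variable (C : forall k : nat, 'rV[R]_k.+1 -> operator X).
Hypothesis hC0 : forall s : R, unitI s -> op_eq (C (const_mx s : 'rV_1)) (A s).
Variable mu : 'rV[R]_p.+1 -> R[i]^o.
Hypothesis hcomm : forall (k : nat) (s : 'rV[R]_k.+1) (t tau : R),
  (k < p)%N -> cube s -> unitI t -> 0 <= tau ->
  op_ext (op_comp (C s) (op_of (E t tau)))
         (op_comp (op_of (E t tau)) (commutator_sum C mu s t tau)).
Hypothesis hmu : {within @cube R p.+1, continuous mu}.

Local Notation Y := (max_cont_subspace p C).
Local Notation coeff := (coeff C mu).
Local Notation taylor := (taylor p).
Local Notation admissible := (@admissible R p).
Local Notation bounded_by := (@bounded_by R X p).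
Local Notation equicontinuous_at := (@equicontinuous_at R X p).
Implicit Types (a g h r s t e K : R) (x y z : X) (l : seq R) (H : seq R -> X).
Implicit Types (m n i j k : nat).

Lemma semigroup_lin t h : unitI t -> 0 <= h -> linear_map (E t h).
Proof. by move=> tI h0; have [[Eb _ _ _] _] := hA tI; have [] := Eb h h0. Qed.

Lemma semigroup0 t x : unitI t -> E t 0 x = x.
Proof. by move=> tI; have [[_ E0 _ _] _] := hA tI. Qed.

Lemma semigroupD t g h x : unitI t -> 0 <= g -> 0 <= h ->
  E t (g + h) x = E t g (E t h x).
Proof. by move=> tI; have [[_ _ ED _] _] := hA tI; exact: ED. Qed.

Lemma semigroup_cont t x h : unitI t -> 0 <= h -> forall e, 0 < e ->
  exists2 d, 0 < d & forall h', 0 <= h' -> `|h - h'| < d ->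
    rnorm (E t h x - E t h' x) <= e.
Proof.
move=> tI h0 e e0; have [[_ _ _ Ec] _] := hA tI.
by have /within_continuousP/(_ h h0 e e0)[d d0 hd] := Ec x; exists d.
Qed.

Lemma semigroup_diff t x : unitI t -> op_dom (A t) x -> forall e, 0 < e ->
  exists2 d, 0 < d & forall h, 0 < h -> h < d ->
    rnorm (E t h x - x - h%:C *: A t x) <= e * h.
Proof.
move=> tI xD e e0; have [_ [_ [Adom Aval]]] := hA tI.
have /cvg_ex[y yx] := Adom x xD.
have <- : y = A t x by rewrite -(Aval x xD) /=; apply/esym/cvg_lim.
have /rnorm_cvgP/(_ e e0) := yx.
rewrite /prop_near1 /at_right /within /= => /nbhs_ballP[d /= d0 hd].
exists d => // h h0 hlt; have := hd h.
rewrite /ball /= sub0r normrN gtr0_norm // => /(_ hlt h0).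
have hN0 : h != 0 by rewrite gt_eqF.
have -> : E t h x - x - h%:C *: y = h%:C *: (generator_quotient (E t) x h - y).
  rewrite scalerBr /generator_quotient scalerA -rmorphM divff //.
  by rewrite scale1r.
by rewrite rnormB rnormZr (gtr0_norm h0) mulrC => /(ler_wpM2r (ltW h0)).
Qed.

(** Stability constant for products of total duration at most 1. *)
Definition stab_const : R := M * expR `|omega|.

Lemma stab_const_ge1 : 1 <= stab_const.
Proof.
rewrite /stab_const -[1]mulr1 ler_pM //.
by rewrite -expR0 ler_expR.
Qed.

Lemma stable_bound (l : seq (R * R)) x :
  (forall ts, ts \in l -> unitI ts.1 /\ 0 <= ts.2) ->
  sorted <=%R [seq ts.1 | ts <- l] -> \sum_(ts <- l) ts.2 <= 1 ->
  rnorm (semigroup_prod E l x) <= stab_const * rnorm x.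
Proof.
move=> lI ls l1; have := hstable lI ls x; rewrite !rnormE -rmorphM lecR.
move=> /le_trans; apply; apply: ler_wpM2r; first exact: rnorm_ge0.
apply: ler_wpM2l; first exact: le_trans ler01 hM.
rewrite ler_expR; have l0 : 0 <= \sum_(ts <- l) ts.2.
  by rewrite big_seq sumr_ge0 // => ts /lI[].
apply: le_trans (ler_norm _) _; rewrite normrM (ger0_norm l0).
by rewrite -[leRHS]mulr1 ler_wpM2l.
Qed.

Lemma semigroup_bound t h x : unitI t -> 0 <= h -> h <= 1 ->
  rnorm (E t h x) <= stab_const * rnorm x.
Proof.
move=> tI h0 h1; have := @stable_bound [:: (t, h)] x; apply => //=.
  by move=> ts; rewrite inE => /eqP ->.
by rewrite big_seq1.
Qed.

Lemma coeffA a y : unitI a -> in_domains p C y -> op_dom (A a) y /\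
  coeff y [:: a] = A a y.
Proof.
move=> aI yD; have [[dom1 val1] [dom2 val2]] := hC0 aI.
have aC : cube (const_mx a : 'rV[R]_1) by move=> i; rewrite mxE.
have yC := yD _ _ hp aC; split; first exact: dom2.
rewrite (@coeffE _ _ _ _ _ 0) // (_ : row_of 1 [:: a] = const_mx a) ?val2 //.
  by apply/rowP => i; rewrite !mxE (ord1 i).
Qed.

(** The commutation relation in terms of families: the semigroup of A(a) acts on the
    coefficients of y through the Taylor map at a. At the top level the
    coefficient is multiplication by mu(l), which commutes with E a h. *)
Lemma semigroup_coeff a h y : unitI a -> 0 <= h -> in_domains p C y ->
  in_domains p C (E a h y) /\
  forall l, admissible l -> coeff (E a h y) l = E a h (taylor a h (coeff y) l).
Proof.
move=> aI h0 yD.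
have ext k (s : 'rV[R]_k.+1) : (k < p)%N -> cube s ->
    op_dom (C s) (E a h y) /\
    C s (E a h y) = E a h (taylor a h (coeff y) (seq_of s)).
  move=> kp cs; have [dom val] := hcomm kp cs aI h0.
  have yS : op_dom (op_comp (op_of (E a h)) (commutator_sum C mu s a h)) y.
    split=> //; split=> //= j; apply: yD; first by have := ltn_ord j; lia.
    by move=> i; rewrite mxE; case: ifP.
  split; first by have [_] := dom y yS.
  rewrite -[LHS]/(op_comp (C s) (op_of (E a h)) y) val //=; congr (E a h _).
  rewrite /taylor size_seq_of subSS big_ord_recr /=; congr (_ + _).
    apply: eq_bigr => j _; congr (_ *: _).
    have jp := ltn_ord j.
    rewrite (@coeffE _ _ _ _ _ (k + j)%N) ?size_cat ?size_seq_of ?size_nseq //; last by lia.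
    congr (C _ y); rewrite -[in LHS](seq_ofK s) row_of_pad ?size_seq_of //; last by lia.
    by congr (row_of _ (_ ++ nseq _ _)); lia.
  rewrite coeff_last; last by rewrite size_cat size_seq_of size_nseq; lia.
  rewrite scalerA mulrC; congr ((_ * mu _) *: _).
  by rewrite -[in LHS](seq_ofK s) row_of_pad ?size_seq_of //; lia.
split; first by move=> k s kp cs; have [] := ext k s kp cs.
move=> l [l0 lp hl].
have [lp'|pl] := leqP (size l) p; last first.
  have {lp pl} lp : size l = p.+1 by lia.
  by rewrite taylor_last // !coeff_last // (linear_mapZ (semigroup_lin aI h0)).
have lk : size l = (size l).-1.+1 by lia.
rewrite (coeffE C mu (E a h y) lk); last by lia.
rewrite (ext _ _ _ (cube_row_of hl lk)).2; last by lia.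
congr (E a h (taylor _ _ _ _)).
exact: row_ofK.
Qed.

Definition stepU n i h : X -> X := E (node R n i) h.
Definition stepG n i h : (seq R -> X) -> seq R -> X := taylor (node R n i) h.
(** The product approximation with generators frozen at the left end points of n+1
    equal cells. *)
Definition approx n t s x : X := evol n (stepU n) t s x.
(** The map that the commutation relation produces on coefficient families when an
    operator C(l) is moved through all factors of approx n t s. *)
Definition approx_coeff n t s H : seq R -> X := evol n (stepG n) t s H.

Lemma stepU0 n i x : (i <= n)%N -> stepU n i 0 x = x.
Proof. by move=> ni; apply/semigroup0/node_unitI. Qed.

Lemma stepUD n i g h x : (i <= n)%N -> 0 <= g -> 0 <= h ->
  stepU n i (g + h) x = stepU n i g (stepU n i h x).
Proof. by move=> ni; apply/semigroupD/node_unitI. Qed.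

Lemma stepG0 n i H : (i <= n)%N -> stepG n i 0 H = H.
Proof. by move=> _; apply: taylor0. Qed.

Lemma stepGD n i g h H : (i <= n)%N -> 0 <= g -> 0 <= h ->
  stepG n i (g + h) H = stepG n i g (stepG n i h H).
Proof. by move=> _ _ _; apply: taylorD. Qed.

Lemma approx_refl n t x : approx n t t x = x.
Proof. exact: evol_refl (@stepU0 n) _ _. Qed.

Lemma approx_trans n t s r x : r <= s -> s <= t ->
  approx n t s (approx n s r x) = approx n t r x.
Proof. exact: evol_trans (@stepU0 n) (@stepUD n) _ _ _ _. Qed.

Lemma approx_local n i t s x : (i <= n)%N -> node R n i <= s -> s <= t ->
  t <= node R n i.+1 -> approx n t s x = E (node R n i) (t - s) x.
Proof. by move=> ni si st ti; rewrite /approx (evol_local (@stepU0 n) (i := i)). Qed.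

Lemma approx_coeff_refl n t H : approx_coeff n t t H = H.
Proof. exact: evol_refl (@stepG0 n) _ _. Qed.

Lemma approx_coeff_trans n t s r H : r <= s -> s <= t ->
  approx_coeff n t s (approx_coeff n s r H) = approx_coeff n t r H.
Proof. exact: evol_trans (@stepG0 n) (@stepGD n) _ _ _ _. Qed.

Lemma approx_coeff_local n i t s H : (i <= n)%N -> node R n i <= s -> s <= t ->
  t <= node R n i.+1 -> approx_coeff n t s H = taylor (node R n i) (t - s) H.
Proof. by move=> ni si st ti; rewrite /approx_coeff (evol_local (@stepG0 n) (i := i)). Qed.

Lemma cell_prod_lin n m t s : (m <= n.+1)%N -> s <= t ->
  linear_map (cell_prod n (stepU n) m t s).
Proof.
move=> + st; elim: m => // m IH mn c x y /=.
rewrite (IH (ltnW mn)) /stepU semigroup_lin //; first exact: node_unitI.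
exact: overlap_ge0.
Qed.

Lemma approx_lin n t s : s <= t -> linear_map (approx n t s).
Proof. exact: cell_prod_lin. Qed.

Lemma approx_bound n t s x : 0 <= s -> s <= t -> t <= 1 ->
  rnorm (approx n t s x) <= stab_const * rnorm x.
Proof.
move=> s0 st t1.
pose L m := [seq (node R n i, overlap n i t s) | i <- iota 0 m].
have -> : approx n t s x = semigroup_prod E (L n.+1) x.
  rewrite /approx /evol; elim: n.+1 => // m IH.
  have -> : L m.+1 = rcons (L m) (node R n m, overlap n m t s).
    by rewrite /L -addn1 iotaD map_cat cats1.
  by rewrite /semigroup_prod foldl_rcons -/(semigroup_prod E (L m) x) -IH.
apply: stable_bound.
- move=> ts /mapP[j]; rewrite mem_iota => /= nj ->.
  by split; [exact: node_unitI | exact: overlap_ge0].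
- rewrite -map_comp; apply: (homo_sorted (e := leq)); last exact: iota_sorted.
  by move=> i j ij; exact: le_node.
- rewrite big_map -[iota 0 n.+1]/(index_iota 0 n.+1) big_mkord /=.
  exact: sum_overlap_le1.
Qed.

Lemma taylor_eq a h H H' l : unitI a -> admissible l ->
  (forall l', admissible l' -> H l' = H' l') -> taylor a h H l = taylor a h H' l.
Proof.
move=> aI al HH'; apply: eq_bigr => j _; congr (_ *: _); apply: HH'.
apply: admissible_cat0 => //; case: al => l0 lp _.
by case: j => -[|j] //=; rewrite ?orbT // orbF; lia.
Qed.

(** Moving C(l) through the factors one after the other. On the right the unbounded
    operators act on y alone, which is the source of all estimates uniform in n. *)
Lemma approx_coeffE n t s y : s <= t -> in_domains p C y ->
  in_domains p C (approx n t s y) /\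
  forall l, admissible l ->
    coeff (approx n t s y) l = approx n t s (approx_coeff n t s (coeff y) l).
Proof.
move=> st yD; rewrite /approx /approx_coeff /evol.
suff prefix m : (m <= n.+1)%N -> in_domains p C (cell_prod n (stepU n) m t s y) /\
  forall l, admissible l -> coeff (cell_prod n (stepU n) m t s y) l =
    cell_prod n (stepU n) m t s (cell_prod n (stepG n) m t s (coeff y) l).
  exact: prefix.
elim: m => // m IH mn; have [mD mE] := IH (ltnW mn).
have mI : unitI (node R n m) by apply: node_unitI.
have h0 := overlap_ge0 n m st.
have [D1 E1] := semigroup_coeff mI h0 mD; split => // l al /=.
rewrite /stepU /stepG E1 //; congr (E _ _ _).
rewrite (taylor_eq _ mI al mE) /taylor (linear_map_sum (cell_prod_lin (ltnW mn) st)).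
by [].
Qed.

(** * Bounds uniform in the partition *)

Local Notation S := stab_const.

(** The factor by which coefficient bounds can grow over the unit interval: the
    growth over a duration h is at most exp((p+1) h). *)
Definition taylor_const : R := expR p.+1%:R.
Local Notation T := taylor_const.

Lemma stab_const_ge0 : 0 <= S.
Proof. exact: le_trans ler01 stab_const_ge1. Qed.

Lemma taylor_const_ge0 : 0 <= T.
Proof. exact: expR_ge0. Qed.

Lemma expR_le_taylor_const c : c <= 1 -> expR (p.+1%:R * c) <= T.
Proof. by move=> c1; rewrite ler_expR -[leRHS]mulr1 ler_wpM2l. Qed.

Lemma approx_coeff_step n i r r' s H : (i <= n)%N -> s <= r -> node R n i <= r ->
  r <= r' -> r' <= node R n i.+1 ->
  approx_coeff n r' s H = taylor (node R n i) (r' - r) (approx_coeff n r s H).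
Proof.
move=> ni sr ir rr' r'i.
by rewrite -(approx_coeff_trans _ _ sr rr') (approx_coeff_local _ ni).
Qed.

Lemma approx_step n i r r' s x : (i <= n)%N -> s <= r -> node R n i <= r ->
  r <= r' -> r' <= node R n i.+1 ->
  approx n r' s x = E (node R n i) (r' - r) (approx n r s x).
Proof.
by move=> ni sr ir rr' r'i; rewrite -(approx_trans _ _ sr rr') (approx_local _ ni).
Qed.

Section Estimates.
Variable n : nat.

Lemma approx_coeff_bounded t s K H : 0 <= s -> s <= t -> t <= 1 -> 0 <= K ->
  bounded_by K H -> bounded_by (K * T) (approx_coeff n t s H).
Proof.
move=> s0 st t1 K0 hH l al.
pose P r := bounded_by (K * expR (p.+1%:R * (r - s))) (approx_coeff n r s H).
suff Pt : P t.
  apply: le_trans (Pt l al) _; apply: ler_wpM2l => //.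
  by apply: expR_le_taylor_const; lra.
apply: (cell_ind (n := n) s0 st t1) => [|i r r' ni sr ir rr' r'i r't Pr] {l al} l al.
  by rewrite approx_coeff_refl subrr mulr0 expR0 mulr1; exact: hH.
rewrite (approx_coeff_step _ ni sr) //.
have -> : r' - s = (r - s) + (r' - r) by lra.
rewrite mulrDr expRD mulrA; apply: taylor_bound; [lra|lra|] => j jl.
by apply: Pr; apply: admissible_cat0 => //; exact: node_unitI.
Qed.

Lemma approx_coeff_equi t s d e H : 0 <= s -> s <= t -> t <= 1 -> 0 < d -> 0 <= e ->
  equicontinuous_at H d e -> equicontinuous_at (approx_coeff n t s H) d (e * T).
Proof.
move=> s0 st t1 d0 e0 hH l l' al al' ll'.
pose P r := equicontinuous_at (approx_coeff n r s H) d (e * expR (p.+1%:R * (r - s))).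
suff Pt : P t.
  apply: le_trans (Pt l l' al al' ll') _; apply: ler_wpM2l => //.
  by apply: expR_le_taylor_const; lra.
apply: (cell_ind (n := n) s0 st t1) => [|i r r' ni sr ir rr' r'i r't Pr]
  {l al l' al' ll'} l l' al al' ll'.
  by rewrite approx_coeff_refl subrr mulr0 expR0 mulr1; exact: hH.
rewrite (approx_coeff_step _ ni sr) //.
have -> : r' - s = (r - s) + (r' - r) by lra.
have iI : unitI (node R n i) by exact: node_unitI.
rewrite mulrDr expRD mulrA; apply: taylor_dist; [lra|lra|exact: ll'.1|] => j jl.
apply: Pr; [exact: admissible_cat0|apply: admissible_cat0 => //|exact: close_cat].
by rewrite -ll'.1.
Qed.

Lemma approx_coeff_lip t s K H l : 0 <= s -> s <= t -> t <= 1 -> 0 <= K ->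
  bounded_by K H -> admissible l ->
  rnorm (approx_coeff n t s H l - H l) <= p.+1%:R * (K * T) * (t - s).
Proof.
move=> s0 st t1 K0 hH al.
pose P r := rnorm (approx_coeff n r s H l - H l) <= p.+1%:R * (K * T) * (r - s).
apply: (cell_ind (P := P) (n := n) s0 st t1) => [|i r r' ni sr ir rr' r'i r't Pr].
  by rewrite /P approx_coeff_refl !subrr rnorm0 mulr0.
rewrite /P (approx_coeff_step _ ni sr) //.
set G := approx_coeff n r s H.
apply: le_trans (rnorm_tri (G l) _ _) _.
have h1 : rnorm (taylor (node R n i) (r' - r) G l - G l) <= p.+1%:R * (K * T) * (r' - r).
  apply: taylor_lip; [lra|lra|by rewrite mulr_ge0 // taylor_const_ge0|] => j jl.
  apply: (approx_coeff_bounded s0 sr) => //; first lra.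
  by apply: admissible_cat0; rewrite ?jl //; exact: node_unitI.
by rewrite /P -/G in Pr; lra.
Qed.

Lemma approx_coeff_lip2 t r s K H l : 0 <= s -> s <= r -> r <= t -> t <= 1 -> 0 <= K ->
  bounded_by K H -> admissible l ->
  rnorm (approx_coeff n t s H l - approx_coeff n r s H l) <=
    p.+1%:R * (K * T * T) * (t - r).
Proof.
move=> s0 sr rt t1 K0 hH al; rewrite -(approx_coeff_trans _ _ sr rt).
apply: approx_coeff_lip => //; [lra|by rewrite mulr_ge0 ?taylor_const_ge0|].
by apply: approx_coeff_bounded => //; lra.
Qed.

Lemma approx_coeff_bound t s K y : 0 <= s -> s <= t -> t <= 1 -> 0 <= K ->
  in_domains p C y -> bounded_by K (coeff y) ->
  bounded_by (S * (K * T)) (coeff (approx n t s y)).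
Proof.
move=> s0 st t1 K0 yD yK l al; rewrite (approx_coeffE n st yD).2 //.
apply: le_trans (approx_bound _ _ s0 st t1) _.
by apply: ler_wpM2l; [exact: stab_const_ge0|exact: approx_coeff_bounded].
Qed.

(** The curve r |-> E a r z has forward derivative E a r (A a z), of norm at most
    stab_const * rnorm (A a z). *)
Lemma semigroup_lip a h z : unitI a -> 0 <= h -> h <= 1 -> op_dom (A a) z ->
  rnorm (E a h z - z) <= S * rnorm (A a z) * h.
Proof.
move=> aI h0 h1 zD.
have S1 := stab_const_ge1.
have := @mean_value _ _ (fun r => E a r z) 0 h (S * rnorm (A a z)) h0.
rewrite semigroup0 // subr0; apply.
  move=> t t0 th e e0; have [d d0 hd] := semigroup_cont z aI (ltW t0) e0.
  by exists d => // s s0 st std; apply: hd => //; rewrite gtr0_norm ?subr_gt0.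
move=> t t0 th e e0.
have e'0 : 0 < e / S by rewrite divr_gt0 //; lra.
have [d d0 hd] := semigroup_diff aI zD e'0.
exists d => // g g0 gd tg; rewrite semigroupD //; last exact: ltW.
rewrite -(linear_mapB (semigroup_lin aI t0)).
apply: le_trans (semigroup_bound _ aI t0 _) _; first lra.
have -> : (S * rnorm (A a z) + e) * g = S * (rnorm (A a z) * g + e / S * g).
  by field; rewrite gt_eqF //; lra.
apply: ler_wpM2l; first exact: stab_const_ge0.
have := rnormD (E a g z - z - g%:C *: A a z) (g%:C *: A a z).
rewrite subrK rnormZr gtr0_norm //; have := hd g g0 gd; lra.
Qed.

(** On a cell the increment is controlled by A(a) applied to the current product, which
    is the coefficient of that product at the list [:: a]; the bound does not
    depend on n. *)
Lemma approx_lip t s K z : 0 <= s -> s <= t -> t <= 1 -> 0 <= K ->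
  in_domains p C z -> bounded_by K (coeff z) ->
  rnorm (approx n t s z - z) <= S * (S * (K * T)) * (t - s).
Proof.
move=> s0 st t1 K0 zD zK.
pose P r := rnorm (approx n r s z - z) <= S * (S * (K * T)) * (r - s).
apply: (cell_ind (P := P) (n := n) s0 st t1) => [|i r r' ni sr ir rr' r'i r't Pr].
  by rewrite /P approx_refl !subrr rnorm0 mulr0.
rewrite /P (approx_step _ ni sr) //.
have iI : unitI (node R n i) by exact: node_unitI.
have [wD wA] := coeffA iI (approx_coeffE n sr zD).1.
have := semigroup_lip (h := r' - r) iI _ _ wD; rewrite -wA.
move=> /(_ _ _)/le_trans h.
apply: le_trans (rnorm_tri (approx n r s z) _ _) _.
have h1 : rnorm (E (node R n i) (r' - r) (approx n r s z) - approx n r s z) <=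
    S * (S * (K * T)) * (r' - r).
  apply: h; [lra|lra|]; apply: ler_wpM2r; first lra.
  apply: ler_wpM2l; first exact: stab_const_ge0.
  apply: (approx_coeff_bound s0 sr) => //; first lra.
  by split => // b; rewrite inE => /eqP ->.
by rewrite /P in Pr; lra.
Qed.

End Estimates.

(** * Convergence of the coefficients *)

Lemma mesh_small d : 0 < d -> exists N, forall n, (N <= n)%N -> mesh R n < d.
Proof.
move=> d0; exists (Num.truncn d^-1) => n Nn.
rewrite /mesh invf_plt ?posrE ?ltr0n //.
apply: lt_le_trans (truncnS_gt _) _; by rewrite ler_nat ltnS.
Qed.

Lemma right_node n r : 0 <= r -> r < 1 -> exists i, [/\ (i <= n)%N,
  unitI (node R n i), node R n i <= r, r < node R n i.+1 &
  `|node R n i - r| < mesh R n].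
Proof.
move=> r0 r1; have [i ni /andP[h1 h2]] := locate n r0 r1.
exists i; split => //; first exact: node_unitI.
by move: h2; rewrite nodeS distrC ger0_norm ?subr_ge0 //; lra.
Qed.

Lemma admissible1 a : unitI a -> admissible [:: a].
Proof. by move=> aI; split => // b; rewrite inE => /eqP ->. Qed.

Lemma close1 d a b : 0 < d -> `|a - b| < d -> close d [:: a] [:: b].
Proof.
by move=> d0 ab; split => // -[|i] //=; rewrite nth_nil subrr normr0.
Qed.

Lemma close_rcons d l a b : 0 < d -> `|a - b| < d -> close d (rcons l a) (rcons l b).
Proof.
move=> d0 ab; split; first by rewrite !size_rcons.
move=> i; rewrite !nth_rcons; case: ifP => _; first by rewrite subrr normr0.
by case: ifP => _ //; rewrite subrr normr0.
Qed.

Lemma admissible_rcons l a : unitI a -> admissible l -> (size l <= p)%N ->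
  admissible (rcons l a).
Proof.
move=> aI al lp; rewrite -cats1; apply: (admissible_cat (j := 1)) => //.
by rewrite addn1.
Qed.

Lemma approx_coeff_right n r s K H l : 0 <= s -> s <= r -> r < 1 -> 0 <= K ->
  bounded_by K H -> admissible l -> (size l <= p)%N ->
  exists a, [/\ unitI a, `|a - r| < mesh R n & exists2 d, 0 < d &
    forall h, 0 < h -> h < d -> r + h <= 1 ->
    rnorm (approx_coeff n (r + h) s H l - approx_coeff n r s H l -
           h%:C *: approx_coeff n r s H (rcons l a)) <= p.+1%:R * (K * T) * h ^+ 2].
Proof.
move=> s0 sr r1 K0 hH al lp; have r0 : 0 <= r by lra.
have [i [ni iI ir ri imesh]] := right_node n r0 r1.
exists (node R n i); split => //.
exists (node R n i.+1 - r); first by lra.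
move=> h h0 hd rh.
rewrite (@approx_coeff_step n i r) //; [|lra|lra].
have -> : r + h - r = h by lra.
apply: taylor_diff => //; [lra|lra|by rewrite mulr_ge0 ?taylor_const_ge0|] => j jl.
apply: approx_coeff_bounded => //; first lra.
by apply: admissible_cat0; rewrite ?jl.
Qed.

(** Downward induction on the level. At the top level the Taylor maps do nothing.
    Below it, the forward derivative of G_n(t) l is G_n(t)(l, a) with a within the
    mesh of t; for two partitions these derivatives differ by the convergence at
    the next level and by equicontinuity in the last parameter, and the mean value
    inequality integrates the difference. *)
Lemma approx_coeff_cauchy y : Y y -> forall e, 0 < e ->
  exists N, forall n m s t l, (N <= n)%N -> (N <= m)%N -> 0 <= s -> s <= t -> t <= 1 ->
    admissible l ->
    rnorm (approx_coeff n t s (coeff y) l - approx_coeff m t s (coeff y) l) <= e.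
Proof.
move=> yY; have [K K0 yK] := max_cont_subspace_bounded hmu yY.
have T0 := taylor_const_ge0; have T1 : 0 < T by rewrite expR_gt0.
suff level k : (k <= p)%N -> forall e, 0 < e -> exists N, forall n m s t l,
    (N <= n)%N -> (N <= m)%N -> 0 <= s -> s <= t -> t <= 1 -> admissible l ->
    (p.+1 <= size l + k)%N ->
    rnorm (approx_coeff n t s (coeff y) l - approx_coeff m t s (coeff y) l) <= e.
  move=> e e0; have [N hN] := level p (leqnn p) e e0.
  exists N => n m s t l Nn Nm s0 st t1 al; apply: hN => //.
  by case: (al) => l0 _ _; lia.
elim: k => [_ e e0|k IH kp e e0].
  exists 0%N => n m s t l _ _ s0 st t1 al; rewrite addn0 => pl.
  have lp : size l = p.+1 by case: (al); lia.
  have last n' : approx_coeff n' t s (coeff y) l = coeff y l.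
    pose P r := approx_coeff n' r s (coeff y) l = coeff y l.
    apply: (cell_ind (P := P) (n := n') s0 st t1) => [|i r r' ni sr ir rr' r'i r't Pr].
      by rewrite /P approx_coeff_refl.
    by rewrite /P (approx_coeff_step _ ni sr) // taylor_last.
  by rewrite !last subrr rnorm0 ltW.
have e20 : 0 < e / 2 by lra.
have eT0 : 0 < e / 2 / T by rewrite divr_gt0.
have [N1 hN1] := IH (ltnW kp) _ e20.
have [d d0 hd] := max_cont_subspace_equi hmu yY eT0.
have [N2 hN2] := mesh_small (d := d / 2) ltac:(lra).
exists (maxn N1 N2) => n m s t l; rewrite !geq_max.
move=> /andP[N1n N2n] /andP[N1m N2m] s0 st t1 al ll.
(* A list with at most k missing entries is covered by the induction hypothesis. *)
have [ll'|ll'] := leqP (p.+1) (size l + k)%N.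
  by apply: le_trans (hN1 n m s t l _ _ _ _ _ _ _) _ => //; lra.
have lp : (size l <= p)%N by clear - ll ll'; lia.
pose c := p.+1%:R * (K * T).
have c0 : 0 <= c by rewrite mulr_ge0 // mulr_ge0.
pose f r := approx_coeff n r s (coeff y) l - approx_coeff m r s (coeff y) l.
have fs : f s = 0 by rewrite /f !approx_coeff_refl subrr.
have := @mean_value_lip _ _ f s t e (2 * (p.+1%:R * (K * T * T))) st.
rewrite fs subr0 => mv; apply: le_trans (mv _ _ _) _.
- by rewrite !mulr_ge0.
- move=> r r' sr rr' r't; rewrite /f.
  have r'1 : r' <= 1 by lra.
  have hn := approx_coeff_lip2 n s0 sr rr' r'1 K0 yK al.
  have hm := approx_coeff_lip2 m s0 sr rr' r'1 K0 yK al.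
  by apply: le_trans (rnormB2 _ _ _ _) _; rewrite -(mulrA 2) mulr_natl mulr2n lerD.
- move=> r sr rt e' e'0.
  have r1 : r < 1 by exact: lt_le_trans rt t1.
  have [a [aI ar [da da0 hda]]] := approx_coeff_right n s0 sr r1 K0 yK al lp.
  have [b [bI br [db db0 hdb]]] := approx_coeff_right m s0 sr r1 K0 yK al lp.
  have ec : 0 < e' / (2 * c + 1) by rewrite divr_gt0 // ltr_wpDl // mulr_ge0.
  exists (Num.min (e' / (2 * c + 1)) (Num.min da db)).
    by rewrite !lt_min ec da0 db0.
  move=> h h0; rewrite !lt_min => /and3P[hec hha hhb] rh.
  have rh1 : r + h <= 1 by apply: le_trans rh t1.
  have h1 := hda h h0 hha rh1; have h2 := hdb h h0 hhb rh1.
  rewrite -/c in h1 h2.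
  set Gn := approx_coeff n; set Gm := approx_coeff m.
  have ab : `|a - b| < d.
    rewrite [d]splitr; apply: le_lt_trans (ler_distD r a b) _.
    rewrite (distrC r b); apply: ltrD; first exact: lt_trans ar (hN2 n N2n).
    exact: lt_trans br (hN2 m N2m).
  have h3 : rnorm (Gn r s (coeff y) (rcons l a) - Gn r s (coeff y) (rcons l b)) <= e / 2.
    have eq_e : e / 2 / T * T = e / 2 by rewrite divfK // gt_eqF.
    rewrite -[leRHS]eq_e; exact: (approx_coeff_equi n s0 sr (ltW r1) d0 (ltW eT0) hd
      (admissible_rcons aI al lp) (admissible_rcons bI al lp) (close_rcons l d0 ab)).
  have h4 : rnorm (Gn r s (coeff y) (rcons l b) - Gm r s (coeff y) (rcons l b)) <= e / 2.
    apply: hN1 => //; [exact: ltW|exact: admissible_rcons|].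
    by rewrite size_rcons addSnnS.
  have h5 := rnorm_tri (Gn r s (coeff y) (rcons l b))
    (Gn r s (coeff y) (rcons l a)) (Gm r s (coeff y) (rcons l b)).
  apply: le_trans (rnormB3 _ _ _ _ (h%:C *: Gn r s (coeff y) (rcons l a))
    (h%:C *: Gm r s (coeff y) (rcons l b))) _.
  rewrite -scalerBr rnormZr gtr0_norm //.
  exact: (quadratic_error_bound c0 h0 hec h1 h2 h3 h4 h5).
- by rewrite -[leRHS]mulr1; apply: ler_wpM2l; lra.
Qed.

(** * Convergence of the products *)

Lemma stab_const_gt0 : 0 < S.
Proof. exact: lt_le_trans ltr01 stab_const_ge1. Qed.

(** For a short time after r only the cell containing r is active, both in the
    product up to r and in the product starting at r. *)
Lemma approx_right n r s x : 0 <= r -> r < 1 ->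
  exists a, [/\ unitI a, `|a - r| < mesh R n & exists2 d, 0 < d &
    forall h, 0 <= h -> h < d ->
      r + h <= 1 /\ (s <= r -> approx n (r + h) s x = E a h (approx n r s x)) /\
      forall t z, r + h <= t -> approx n t r z = approx n t (r + h) (E a h z)].
Proof.
move=> r0 r1; have [i [ni iI ir ri imesh]] := right_node n r0 r1.
exists (node R n i); split => //.
have i1 : node R n i.+1 <= 1 by rewrite -(node_last R n) le_node.
exists (node R n i.+1 - r); first by rewrite subr_gt0.
move=> h h0 hd; have rh : r + h <= node R n i.+1 by lra.
have rr : r <= r + h by rewrite lerDl.
have hh : r + h - r = h by rewrite addrC addKr.
split; first exact: le_trans rh i1.
split=> [sr|t z rt]; first by rewrite (approx_step x ni sr ir rr rh) hh.
by rewrite -(approx_trans _ _ rr rt) (approx_local z ni ir rr rh) hh.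
Qed.

(** Once A(a) and A(b) are moved to the right of the product, only coefficients of y
    at neighbouring lists have to be compared. *)
Lemma approx_generator_diff n t s d e y a b :
  0 <= s -> s <= t -> t <= 1 -> 0 < d -> 0 <= e ->
  in_domains p C y -> equicontinuous_at (coeff y) d e ->
  unitI a -> unitI b -> `|a - b| < d ->
  rnorm (A a (approx n t s y) - A b (approx n t s y)) <= S * (e * T).
Proof.
move=> s0 st t1 d0 e0 yD yE aI bI ab.
have [wD wE] := approx_coeffE n st yD.
rewrite -(coeffA aI wD).2 -(coeffA bI wD).2 !wE; [|exact: admissible1|exact: admissible1].
rewrite -(linear_mapB (approx_lin n st)).
apply: le_trans (approx_bound _ _ s0 st t1) _.
apply: ler_wpM2l; first exact: stab_const_ge0.
exact: (approx_coeff_equi n s0 st t1 d0 e0 yE (admissible1 aI) (admissible1 bI)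
  (close1 d0 ab)).
Qed.

(** The curve r |-> U_n(t,r) U_m(r,s) y joins U_n(t,s) y to U_m(t,s) y, and its forward
    derivative is U_n(t,r) (A(b) - A(a)) U_m(r,s) y with nodes a and b within the
    meshes of r. *)
Lemma approx_cauchy_core y : Y y -> forall e, 0 < e ->
  exists N, forall n m s t, (N <= n)%N -> (N <= m)%N -> 0 <= s -> s <= t -> t <= 1 ->
    rnorm (approx n t s y - approx m t s y) <= e.
Proof.
move=> yY e e0; have [K K0 yK] := max_cont_subspace_bounded hmu yY.
have yD := max_cont_subspace_dom yY.
have S0 := stab_const_ge0; have S1 := stab_const_gt0.
have T0 := taylor_const_ge0; have T1 : 0 < T by rewrite expR_gt0.
pose e1 := e / (S * (S * T)).
have ST0 : 0 < S * (S * T) := mulr_gt0 S1 (mulr_gt0 S1 T1).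
have e10 : 0 < e1 by exact: divr_gt0.
have [d d0 hd] := max_cont_subspace_equi hmu yY e10.
have [N hN] := mesh_small (d := d / 2) ltac:(lra).
exists N => n m s t Nn Nm s0 st t1.
pose f r := approx n t r (approx m r s y).
have -> : approx n t s y - approx m t s y = f s - f t.
  by rewrite /f !approx_refl.
rewrite rnormB; pose L := S * (S * (S * (K * T) * T)) .
have KT0 : 0 <= K * T := mulr_ge0 K0 T0.
have L0 : 0 <= L by exact: mulr_ge0 S0 (mulr_ge0 S0 (mulr_ge0 (mulr_ge0 S0 KT0) T0)).
apply: (@le_trans _ _ (e * (t - s))); last first.
  rewrite -[leRHS]mulr1; apply: ler_wpM2l; first exact: ltW.
  by rewrite lerBlDr (le_trans t1) // lerDl.
apply: (@mean_value_lip _ _ f s t e (S * (L + L))) => //.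
- exact: mulr_ge0 S0 (addr_ge0 L0 L0).
- move=> r r' sr rr' r't; rewrite /f.
  have r1 : r <= 1 by exact: le_trans rr' (le_trans r't t1).
  have r'1 : r' <= 1 by exact: le_trans t1.
  have r0 : 0 <= r by exact: le_trans sr.
  have r'0 : 0 <= r' by exact: le_trans rr'.
  rewrite -(approx_trans _ _ rr' r't) -(approx_trans m _ sr rr').
  set w := approx m r s y.
  have [wD _] := approx_coeffE m sr yD.
  have wK := approx_coeff_bound m s0 sr r1 K0 yD yK.
  have SK0 : 0 <= S * (K * T) := mulr_ge0 S0 KT0.
  rewrite -(linear_mapB (approx_lin n r't)).
  apply: le_trans (approx_bound _ _ r'0 r't t1) _.
  rewrite -mulrA; apply: ler_wpM2l => //.
  apply: le_trans (rnorm_tri w _ _) _; rewrite mulrDl; apply: lerD.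
    exact: (approx_lip m r0 rr' r'1 SK0 wD wK).
  by rewrite rnormB; exact: (approx_lip n r0 rr' r'1 SK0 wD wK).
- move=> r sr rt e' e'0.
  have r1 : r < 1 by exact: lt_le_trans rt t1.
  have r0 : 0 <= r by exact: le_trans sr.
  have [a [aI ar [da da0 hda]]] := approx_right n s y r0 r1.
  have [b [bI br [db db0 hdb]]] := approx_right m s y r0 r1.
  have ab : `|a - b| < d.
    rewrite [d]splitr; apply: le_lt_trans (ler_distD r a b) _.
    rewrite (distrC r b); apply: ltrD; first exact: lt_trans ar (hN n Nn).
    exact: lt_trans br (hN m Nm).
  set z := approx m r s y.
  have [zD _] := approx_coeffE m sr yD.
  have e2 : 0 < e' / S / 2 by apply: divr_gt0 => //; exact: divr_gt0.
  have [ea ea0 hea] := semigroup_diff aI (coeffA aI zD).1 e2.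
  have [eb eb0 heb] := semigroup_diff bI (coeffA bI zD).1 e2.
  exists (Num.min (Num.min da db) (Num.min ea eb)).
    by rewrite !lt_min da0 db0 ea0 eb0.
  move=> h h0; rewrite !lt_min => /andP[/andP[hha hhb] /andP[hhea hheb]] rh.
  have [rh1 [_ hdat]] := hda h (ltW h0) hha.
  have [_ [hdbt _]] := hdb h (ltW h0) hhb.
  rewrite /f (hdat t _ rh) (hdbt sr) -/z.
  rewrite -(linear_mapB (approx_lin n rh)).
  have rh0 : 0 <= r + h by rewrite addr_ge0 // ltW.
  apply: le_trans (approx_bound _ _ rh0 rh t1) _.
  have h1 := hea h h0 hhea; have h2 := heb h h0 hheb.
  have h3 := approx_generator_diff m s0 sr (ltW r1) d0 (ltW e10) yD hd bI aI
    ltac:(by rewrite distrC).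
  have h4 := rnormB3 (E b h z) (E a h z) z z (h%:C *: A b z) (h%:C *: A a z).
  rewrite subrr subr0 -scalerBr rnormZr gtr0_norm // in h4.
  exact: (stable_increment_bound S1 T1 h0 h2 h1 h3 h4).
Qed.

(** Density of Y and the bound uniform in n. *)
Lemma approx_cauchy (hdense : dense Y) x e : 0 < e ->
  exists N, forall n m s t, (N <= n)%N -> (N <= m)%N -> 0 <= s -> s <= t -> t <= 1 ->
    rnorm (approx n t s x - approx m t s x) <= e.
Proof.
move=> e0; have S1 := stab_const_gt0.
have e1 : 0 < e / 4 / S by do 2!apply: divr_gt0 => //.
have [y yY xy] := denseP hdense x e1.
have [N hN] := approx_cauchy_core yY (e := e / 2) ltac:(lra).
exists N => n m s t Nn Nm s0 st t1.
have hb n' : rnorm (approx n' t s x - approx n' t s y) <= e / 4.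
  rewrite -(linear_mapB (approx_lin n' st)).
  apply: le_trans (approx_bound _ _ s0 st t1) _.
  by move: xy; rewrite ler_pdivlMr // mulrC.
have h1 := hb n; have h2 := hb m; have h3 := hN n m s t Nn Nm s0 st t1.
have h4 := rnorm_tri (approx n t s y) (approx n t s x) (approx m t s x).
have h5 := rnorm_tri (approx m t s y) (approx n t s y) (approx m t s x).
rewrite (rnormB (approx m t s y)) in h5.
lra.
Qed.

(** * The limit and its coefficients *)

Hypothesis hdense : dense Y.
Hypothesis hC : forall (k : nat) (s : 'rV[R]_k.+1), (k < p)%N -> cube s ->
  closed_operator (C s).

Definition propagator t s x : X := lim (approx n t s x @[n --> \oo]).

Definition propagator_coeff t s y l : X :=
  lim (approx_coeff n t s (coeff y) l @[n --> \oo]).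

Local Notation U := propagator.
Local Notation Glim := propagator_coeff.

Lemma propagator_unif x e : 0 < e -> exists N, forall n s t, (N <= n)%N ->
  0 <= s -> s <= t -> t <= 1 -> rnorm (U t s x - approx n t s x) <= e.
Proof.
move=> e0.
pose D (ts : R * R) := [/\ 0 <= ts.2, ts.2 <= ts.1 & ts.1 <= 1].
have [] := @uniform_limit _ _ _ D (fun n ts => approx n ts.1 ts.2 x) _ _ e0.
  move=> e' e'0; have [N hN] := approx_cauchy hdense x e'0.
  by exists N => n m [t s] Nn Nm [/= s0 st t1]; apply: hN.
by move=> N hN; exists N => n s t Nn s0 st t1; apply: (hN n (t, s)).
Qed.

Lemma propagator_coeff_unif y e : Y y -> 0 < e -> exists N, forall n s t l,
  (N <= n)%N -> 0 <= s -> s <= t -> t <= 1 -> admissible l ->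
  rnorm (Glim t s y l - approx_coeff n t s (coeff y) l) <= e.
Proof.
move=> yY e0.
pose D (q : R * R * seq R) :=
  [/\ 0 <= q.1.2, q.1.2 <= q.1.1, q.1.1 <= 1 & admissible q.2].
have [] := @uniform_limit _ _ _ D
    (fun n q => approx_coeff n q.1.1 q.1.2 (coeff y) q.2) _ _ e0.
  move=> e' e'0; have [N hN] := approx_coeff_cauchy yY e'0.
  by exists N => n m [[t s] l] Nn Nm [/= s0 st t1 al]; apply: hN.
by move=> N hN; exists N => n s t l Nn s0 st t1 al; apply: (hN n (t, s, l)).
Qed.

Section Interval.
Variables (s t : R).
Hypotheses (s0 : 0 <= s) (st : s <= t) (t1 : t <= 1).

Lemma propagator_cvg x : approx n t s x @[n --> \oo] --> U t s x.
Proof.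
apply/rnorm_cvgP => e e0; have [N hN] := propagator_unif x e0.
by exists N => // n /= Nn; apply: hN.
Qed.

Lemma propagator_coeff_cvg y l : Y y -> admissible l ->
  approx_coeff n t s (coeff y) l @[n --> \oo] --> Glim t s y l.
Proof.
move=> yY al; apply/rnorm_cvgP => e e0; have [N hN] := propagator_coeff_unif yY e0.
by exists N => // n /= Nn; apply: hN.
Qed.

Lemma propagator_lin : linear_map (U t s).
Proof.
move=> c x y.
have h : approx n t s (c *: x + y) @[n --> \oo] --> c *: U t s x + U t s y.
  under eq_fun do rewrite approx_lin //.
  by apply: cvgD; [apply: cvgZr; exact: propagator_cvg|exact: propagator_cvg].
by apply: cvg_unique h; [exact: norm_hausdorff|exact: propagator_cvg].
Qed.

Lemma propagator_bound x : rnorm (U t s x) <= S * rnorm x.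
Proof.
by apply: rnorm_cvg_le (@propagator_cvg x) _ => n; exact: approx_bound.
Qed.

(** Strong convergence with a uniform bound may be applied to a convergent sequence
    of vectors. *)
Lemma approx_cvg (u : nat -> X) (v : X) : u n @[n --> \oo] --> v ->
  approx n t s (u n) @[n --> \oo] --> U t s v.
Proof.
move=> /rnorm_cvgP uv; apply/rnorm_cvgP => e e0.
have S1 := stab_const_gt0.
have e1 : 0 < e / 2 / S by do 2!apply: divr_gt0 => //.
have e2 : 0 < e / 2 by apply: divr_gt0.
have [N1 hN1] := propagator_unif v e2; have [N2 _ hN2] := uv _ e1.
exists (maxn N1 N2) => // n /=; rewrite geq_max => /andP[N1n N2n].
apply: le_trans (rnorm_tri (approx n t s v) _ _) _; rewrite [e]splitr.
apply: lerD; first exact: hN1.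
rewrite -(linear_mapB (approx_lin n st)).
apply: le_trans (approx_bound _ _ s0 st t1) _.
by have := hN2 n N2n; rewrite ler_pdivlMr // mulrC.
Qed.

(** U_n(t,s) y converges to U(t,s) y while C(l) U_n(t,s) y = U_n(t,s) (G_n(t,s) y)(l)
    converges as well, so closedness of C(l) yields both claims. At the top level
    C(l) is replaced by a scalar and continuity of scaling suffices. *)
Lemma propagator_coeffE y : Y y -> in_domains p C (U t s y) /\
  forall l, admissible l -> coeff (U t s y) l = U t s (Glim t s y l).
Proof.
move=> yY; have yD := max_cont_subspace_dom yY.
have cv l (al : admissible l) :
    coeff (approx n t s y) l @[n --> \oo] --> U t s (Glim t s y l).
  under eq_fun do rewrite (approx_coeffE _ st yD).2 //.
  exact/approx_cvg/propagator_coeff_cvg.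
have graph k (r : 'rV[R]_k.+1) : (k < p)%N -> cube r ->
    op_dom (C r) (U t s y) /\ C r (U t s y) = U t s (Glim t s y (seq_of r)).
  move=> kp cr; have [_ Ccl] := hC kp cr.
  have al : admissible (seq_of r).
    by split; rewrite ?size_seq_of //; [exact: ltnW|exact: seq_of_unitI].
  have Ccv : C r (approx n t s y) @[n --> \oo] --> U t s (Glim t s y (seq_of r)).
    have := cv _ al; under eq_fun do rewrite (@coeffE _ _ _ _ _ k) ?size_seq_of // seq_ofK.
    by [].
  have inC : \forall n \near \oo, op_graph (C r) (approx n t s y, C r (approx n t s y)).
    by exists 0%N => // n _; split => //=; exact: (approx_coeffE n st yD).1.
  have [] // := closed_cvg _ Ccl inC (U t s y, U t s (Glim t s y (seq_of r)))
    (cvg_pair (@propagator_cvg y) Ccv).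
split; first by move=> k r kp cr; exact: (graph k r kp cr).1.
move=> l al; have [l0 lp hl] := al.
have [lp'|pl] := leqP (size l) p; last first.
  have {}lp : size l = p.+1 by apply/eqP; rewrite eqn_leq lp.
  have muE : (fun n => coeff (approx n t s y) l) =
      (fun n => (mu (row_of p.+1 l) : R[i]) *: approx n t s y).
    by apply/funext => n; rewrite coeff_last.
  have := cv l al; rewrite muE coeff_last // => h.
  apply: cvg_unique h; first exact: norm_hausdorff.
  by apply: cvgZr; exact: propagator_cvg.
have lk : size l = (size l).-1.+1 by rewrite prednK.
rewrite (coeffE C mu _ lk); last by rewrite -ltnS -lk ltnS.
rewrite (graph _ _ _ (cube_row_of hl lk)).2 ?row_ofK //.
by rewrite -ltnS -lk ltnS.
Qed.

Lemma coeff_cvg y l : Y y -> admissible l ->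
  coeff (approx n t s y) l @[n --> \oo] --> coeff (U t s y) l.
Proof.
move=> yY al; have yD := max_cont_subspace_dom yY.
rewrite (propagator_coeffE yY).2 //.
under eq_fun do rewrite (approx_coeffE _ st yD).2 //.
exact/approx_cvg/propagator_coeff_cvg.
Qed.

Lemma propagator_coeff_bounded y K : Y y -> 0 <= K -> bounded_by K (coeff y) ->
  bounded_by (S * (K * T)) (coeff (U t s y)).
Proof.
move=> yY K0 yK l al; rewrite (propagator_coeffE yY).2 //.
apply: le_trans (propagator_bound _) _; apply: ler_wpM2l; first exact: stab_const_ge0.
by apply: rnorm_cvg_le (propagator_coeff_cvg yY al) _ => n; exact: approx_coeff_bounded.
Qed.

(** The limits of the coefficients inherit the modulus of continuity in l that is
    common to all n, and U(t,s) is bounded. *)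
Lemma propagator_Y y : Y y -> Y (U t s y).
Proof.
move=> yY; apply: (max_cont_subspaceI (mu := mu)); first exact: (propagator_coeffE yY).1.
move=> e e0; have S1 := stab_const_gt0; have T1 : 0 < T by rewrite expR_gt0.
have e1 : 0 < e / S / T by do 2!apply: divr_gt0 => //.
have [d d0 hd] := max_cont_subspace_equi hmu yY e1.
exists d => // l l' al al' ll'.
rewrite !(propagator_coeffE yY).2 // -(linear_mapB propagator_lin).
apply: le_trans (propagator_bound _) _; rewrite mulrC -ler_pdivlMr //.
have <- : e / S / T * T = e / S by rewrite divfK // gt_eqF.
apply: rnorm_cvg_le (cvgB (propagator_coeff_cvg yY al) (propagator_coeff_cvg yY al')) _.
by move=> n; exact: (approx_coeff_equi n s0 st t1 d0 (ltW e1) hd al al' ll').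
Qed.

Lemma propagator_lip y K : Y y -> 0 <= K -> bounded_by K (coeff y) ->
  rnorm (U t s y - y) <= S * (S * (K * T)) * (t - s).
Proof.
move=> yY K0 yK.
apply: rnorm_cvg_le (cvgB (@propagator_cvg y) (cvg_cst y)) _ => n.
by apply: approx_lip => //; exact: max_cont_subspace_dom.
Qed.

End Interval.

Lemma propagator_refl t x : 0 <= t -> t <= 1 -> U t t x = x.
Proof.
move=> t0 t1; have := propagator_cvg t0 (lexx t) t1 (x := x).
under eq_fun do rewrite approx_refl.
by move=> h; apply: cvg_unique h (cvg_cst _); exact: norm_hausdorff.
Qed.

Lemma propagator_trans t s r x : 0 <= r -> r <= s -> s <= t -> t <= 1 ->
  U t s (U s r x) = U t r x.
Proof.
move=> r0 rs st t1; have s0 := le_trans r0 rs; have s1 := le_trans st t1.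
have := approx_cvg s0 st t1 (propagator_cvg r0 rs s1 (x := x)).
have -> : (fun n => approx n t s (approx n s r x)) = (fun n => approx n t r x).
  by apply/funext => n; rewrite approx_trans.
move=> h; apply: cvg_unique h (propagator_cvg r0 (le_trans rs st) t1 (x := x)).
exact: norm_hausdorff.
Qed.

(** * Strong continuity of the limit *)

Lemma propagator_lip_end y K t t' s : Y y -> 0 <= K -> bounded_by K (coeff y) ->
  0 <= s -> s <= t -> t <= t' -> t' <= 1 ->
  rnorm (U t' s y - U t s y) <= S * (S * (S * (K * T) * T)) * (t' - t).
Proof.
move=> yY K0 yK s0 st tt' t'1; have t1 := le_trans tt' t'1.
rewrite -(propagator_trans y s0 st tt' t'1).
have KT0 : 0 <= S * (K * T) := mulr_ge0 stab_const_ge0 (mulr_ge0 K0 taylor_const_ge0).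
apply: (propagator_lip (le_trans s0 st) tt' t'1 _ KT0).
  exact: propagator_Y.
exact: propagator_coeff_bounded.
Qed.

Lemma propagator_lip_start y K t s s' : Y y -> 0 <= K -> bounded_by K (coeff y) ->
  0 <= s -> s <= s' -> s' <= t -> t <= 1 ->
  rnorm (U t s y - U t s' y) <= S * (S * (S * (K * T))) * (s' - s).
Proof.
move=> yY K0 yK s0 ss' s't t1; rewrite -(propagator_trans y s0 ss' s't t1).
rewrite -(linear_mapB (propagator_lin (le_trans s0 ss') s't t1)).
apply: le_trans (propagator_bound (le_trans s0 ss') s't t1 _) _.
rewrite -mulrA; apply: ler_wpM2l; first exact: stab_const_ge0.
by apply: propagator_lip => //; exact: le_trans s't t1.
Qed.

(** By the evolution property a shift of an end point is a propagator over a short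
    interval applied to a vector with controlled coefficients. *)
Lemma propagator_cont_core y : Y y -> exists2 L, 0 <= L & forall s t s' t',
  0 <= s -> s <= t -> t <= 1 -> 0 <= s' -> s' <= t' -> t' <= 1 ->
  rnorm (U t s y - U t' s' y) <= L * (`|t - t'| + `|s - s'|).
Proof.
move=> yY; have [K K0 yK] := max_cont_subspace_bounded hmu yY.
have S0 := stab_const_ge0; have T0 := taylor_const_ge0.
have KT0 : 0 <= K * T := mulr_ge0 K0 T0.
pose L1 := S * (S * (S * (K * T) * T)); pose L2 := S * (S * (S * (K * T))).
have L10 : 0 <= L1 := mulr_ge0 S0 (mulr_ge0 S0 (mulr_ge0 (mulr_ge0 S0 KT0) T0)).
have L20 : 0 <= L2 := mulr_ge0 S0 (mulr_ge0 S0 (mulr_ge0 S0 KT0)).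
exists (L1 + L2); first exact: addr_ge0.
move=> s t s' t' s0 st t1 s'0 s't' t'1.
have step tM sm r u : 0 <= sm -> sm <= r -> r <= u -> u <= tM -> tM <= 1 ->
    rnorm (U tM sm y - U u r y) <= L1 * (tM - u) + L2 * (r - sm).
  move=> sm0 smr ru utM tM1; apply: le_trans (rnorm_tri (U u sm y) _ _) _.
  apply: lerD; first exact: propagator_lip_end (le_trans smr ru) _ _.
  exact: propagator_lip_start (le_trans utM tM1).
have tri := rnorm_tri (U (Num.max t t') (Num.min s s') y) (U t s y) (U t' s' y).
have h1 := step (Num.max t t') (Num.min s s') s t.
have h2 := step (Num.max t t') (Num.min s s') s' t'.
rewrite le_min s0 s'0 ge_min lexx le_max lexx ge_max t1 t'1 in h1.
rewrite le_min s0 s'0 ge_min lexx orbT le_max lexx orbT ge_max t1 t'1 in h2.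
have {}h1 := h1 isT isT st isT isT; have {}h2 := h2 isT isT s't' isT isT.
rewrite rnormB in h1.
by apply: le_trans tri (le_trans (lerD h1 h2) _); exact: ordered_detour_bound.
Qed.

Lemma propagator_cont x e : 0 < e -> exists2 d, 0 < d & forall s t s' t',
  0 <= s -> s <= t -> t <= 1 -> 0 <= s' -> s' <= t' -> t' <= 1 ->
  `|t - t'| < d -> `|s - s'| < d -> rnorm (U t s x - U t' s' x) <= e.
Proof.
move=> e0; have S1 := stab_const_gt0.
have e1 : 0 < e / 4 / S by do 2!apply: divr_gt0 => //.
have [y yY xy] := denseP hdense x e1.
have [L L0 hL] := propagator_cont_core yY.
have L1 : 0 < L + 1 by exact: ltr_wpDl.
exists (e / 4 / (L + 1)); first by do 2!apply: divr_gt0 => //.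
move=> s t s' t' s0 st t1 s'0 s't' t'1 tt' ss'.
have hb r u : 0 <= r -> r <= u -> u <= 1 -> rnorm (U u r x - U u r y) <= e / 4.
  move=> r0 ru u1; rewrite -(linear_mapB (propagator_lin r0 ru u1)).
  apply: le_trans (propagator_bound r0 ru u1 _) _.
  by move: xy; rewrite ler_pdivlMr // mulrC.
have h1 := hb _ _ s0 st t1; have h2 := hb _ _ s'0 s't' t'1.
have h3 := hL s t s' t' s0 st t1 s'0 s't' t'1.
exact: (approximation_bound L0 (normr_ge0 _) (normr_ge0 _) tt' ss' h1 h2 h3
  (rnorm_tri (U t s y) _ _) (rnorm_tri (U t' s' y) _ _)
  (rnormB _ _)).
Qed.

(** * Differentiability of the limit *)

(** A(a) U_n(r,s) y = U_n(r,s) G with G a coefficient of y at [:: a]. First G is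
    replaced by its limit g at r = t and a = t, with an error uniform in n; as g is
    one fixed vector, strong convergence at g then suffices. *)
Lemma propagator_velocity y s t e : Y y -> 0 <= s -> s <= t -> t <= 1 -> 0 < e ->
  exists d N, 0 < d /\ forall n r a, (N <= n)%N -> s <= r -> r <= 1 ->
    `|r - t| < d -> unitI a -> `|a - t| < d ->
    rnorm (A a (approx n r s y) - A t (U t s y)) <= e.
Proof.
move=> yY s0 st t1 e0; have [K K0 yK] := max_cont_subspace_bounded hmu yY.
have yD := max_cont_subspace_dom yY.
have S0 := stab_const_gt0; have T1 : 0 < T by exact: expR_gt0.
have tI : unitI t by rewrite /unitI /= t1 (le_trans s0 st).
have at_ := admissible1 tI.
(* Five errors of size e / 5 each: three on the coefficient, scaled down by the
   bound S of the products, and two on the propagator at g. *)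
pose g := Glim t s y [:: t].
pose q := p.+1%:R * (K * T * T).
have q0 : 0 <= q by apply: mulr_ge0 => //; do 2!apply: mulr_ge0 (ltW T1) => //.
have e5 : 0 < e / 5 by exact: divr_gt0.
have e5S : 0 < e / 5 / S by exact: divr_gt0.
have e5ST : 0 < e / 5 / S / T by exact: divr_gt0.
have [d1 d10 hd1] := max_cont_subspace_equi hmu yY e5ST.
have [d2 d20 hd2] := propagator_cont g e5.
have q1 : 0 < q + 1 by exact: ltr_wpDl.
have d30 : 0 < e / 5 / S / (q + 1) by exact: divr_gt0.
have [N1 hN1] := propagator_coeff_unif yY e5S.
have [N2 hN2] := propagator_unif g e5.
exists (Num.min d1 (Num.min d2 (e / 5 / S / (q + 1)))), (maxn N1 N2).
split; first by rewrite !lt_min d10 d20 d30.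
move=> n r a; rewrite geq_max !lt_min.
move=> /andP[N1n N2n] sr r1 /and3P[rt1 rt2 rt3] aI /and3P[at1 _ _].
have [wD wE] := approx_coeffE n sr yD.
rewrite -(coeffA aI wD).2 wE; last exact: admissible1.
rewrite -(coeffA tI (propagator_coeffE s0 st t1 yY).1).2.
rewrite (propagator_coeffE s0 st t1 yY).2 // -/g.
have h1 : rnorm (approx_coeff n r s (coeff y) [:: a] -
                 approx_coeff n r s (coeff y) [:: t]) <= e / 5 / S.
  have <- : e / 5 / S / T * T = e / 5 / S by rewrite divfK // gt_eqF.
  exact: (approx_coeff_equi n s0 sr r1 d10 (ltW e5ST) hd1 (admissible1 aI) at_
    (close1 d10 at1)).
have h2 : rnorm (approx_coeff n r s (coeff y) [:: t] -
                 approx_coeff n t s (coeff y) [:: t]) <= e / 5 / S.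
  have h : q * `|r - t| <= e / 5 / S.
    move: rt3; rewrite ltr_pdivlMr // mulrDr mulr1 => rt3.
    by rewrite mulrC; apply: le_trans (ltW rt3); rewrite lerDl.
  have [rt|tr] := leP r t.
    rewrite rnormB; apply: le_trans (approx_coeff_lip2 n s0 sr rt t1 K0 yK at_) _.
    by move: h; rewrite distrC ger0_norm ?subr_ge0.
  apply: le_trans (approx_coeff_lip2 n s0 st (ltW tr) r1 K0 yK at_) _.
  by move: h; rewrite gtr0_norm ?subr_gt0.
have h3 : rnorm (approx_coeff n t s (coeff y) [:: t] - g) <= e / 5 / S.
  by rewrite rnormB; exact: hN1.
have h4 : rnorm (approx n r s g - U r s g) <= e / 5.
  by rewrite rnormB; exact: hN2.
have h5 : rnorm (U r s g - U t s g) <= e / 5.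
  by apply: hd2 => //; rewrite subrr normr0.
have h6 : rnorm (approx_coeff n r s (coeff y) [:: a] - g) <= e / 5 / S * 3.
  apply: le_trans (rnorm_tri (approx_coeff n r s (coeff y) [:: t]) _ _) _.
  apply: le_trans (lerD h1 (rnorm_tri (approx_coeff n t s (coeff y) [:: t]) _ _)) _.
  apply: le_trans (lerD (lexx _) (lerD h2 h3)) _.
  by move: (e / 5 / S) => u; rewrite (_ : u * 3 = u + (u + u)) //; ring.
apply: le_trans (rnorm_tri (approx n r s g) _ _) _.
rewrite -(linear_mapB (approx_lin n sr)).
apply: le_trans (lerD (approx_bound _ _ s0 sr r1) (rnorm_tri (U r s g) _ _)) _.
apply: le_trans (lerD (ler_wpM2l (ltW S0) h6) (lerD h4 h5)) _.
by rewrite le_eqVlt; apply/orP; left; apply/eqP; field; rewrite gt_eqF.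
Qed.

Lemma approx_right_diff n r s y e : Y y -> 0 <= s -> s <= r -> r < 1 -> 0 < e ->
  exists a, [/\ unitI a, `|a - r| < mesh R n & exists2 d, 0 < d &
    forall h, 0 < h -> h < d -> rnorm (approx n (r + h) s y - approx n r s y -
      h%:C *: A a (approx n r s y)) <= e * h].
Proof.
move=> yY s0 sr r1 e0.
have [a [aI ar [da da0 hda]]] := approx_right n s y (le_trans s0 sr) r1.
have [zD _] := approx_coeffE n sr (max_cont_subspace_dom yY).
have [ea ea0 hea] := semigroup_diff aI (coeffA aI zD).1 e0.
exists a; split => //; exists (Num.min da ea); first by rewrite lt_min da0.
move=> h h0; rewrite lt_min => /andP[hha hhea].
have [_ [hdas _]] := hda h (ltW h0) hha.
by rewrite (hdas sr); exact: hea.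
Qed.

(** With w = A(t) U(t,s) y, the curve r |-> U_n(r,s) y - r w has forward derivative
    A(a) U_n(r,s) y - w, which is small near t for large n. The estimate on
    [t1, t2] passes to the limit in n, and t may lie at either end of the interval,
    so it gives the derivative from both sides. *)
Lemma propagator_diff y s t e : Y y -> 0 <= s -> s <= t -> t <= 1 -> 0 < e ->
  exists2 d, 0 < d & forall t1 t2, s <= t1 -> t1 <= t2 -> t2 <= 1 ->
    `|t1 - t| < d -> `|t2 - t| < d ->
    rnorm (U t2 s y - U t1 s y - (t2 - t1)%:C *: A t (U t s y)) <= e * (t2 - t1).
Proof.
move=> yY s0 st t1 e0; have [K K0 yK] := max_cont_subspace_bounded hmu yY.
have yD := max_cont_subspace_dom yY.
have S0 := stab_const_ge0; have T0 := taylor_const_ge0.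
have [d [N [d0 hN]]] := propagator_velocity yY s0 st t1 e0.
set w := A t (U t s y) in hN *.
have d20 : 0 < d / 2 by exact: divr_gt0.
have [N' hN'] := mesh_small d20.
exists (d / 2) => // r1 r2 sr1 r12 r21 r1t r2t.
have r10 := le_trans s0 sr1; have r11 := le_trans r12 r21.
have cv : approx n r2 s y - approx n r1 s y - (r2 - r1)%:C *: w @[n --> \oo] -->
    U r2 s y - U r1 s y - (r2 - r1)%:C *: w.
  apply: cvgB; last exact: cvg_cst.
  apply: cvgB; last exact: (@propagator_cvg s r1 s0 sr1 r11 y).
  exact: (@propagator_cvg s r2 s0 (le_trans sr1 r12) r21 y).
apply: (@rnorm_cvg_le_near _ _ _ _ _ (maxn N N') cv) => n.
rewrite geq_max => /andP[Nn N'n].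
pose f r := approx n r s y - (r - r1)%:C *: w.
have fB r r' : f r' - f r = approx n r' s y - approx n r s y - (r' - r)%:C *: w.
  rewrite /f subr_interchange -scalerBl -rmorphB; congr (_ - _%:C *: _); ring.
have -> : approx n r2 s y - approx n r1 s y - (r2 - r1)%:C *: w = f r2 - f r1.
  by rewrite fB.
pose L := S * (S * (S * (K * T) * T)) + rnorm w.
have KT0 : 0 <= K * T := mulr_ge0 K0 T0.
have SKT0 : 0 <= S * (K * T) := mulr_ge0 S0 KT0.
have L0 : 0 <= L := addr_ge0 (mulr_ge0 S0 (mulr_ge0 S0 (mulr_ge0 SKT0 T0))) (rnorm_ge0 _).
apply: (@mean_value_lip _ _ f r1 r2 e L) => //.
  move=> r r' r1r rr' r'2; rewrite fB.
  have sr : s <= r := le_trans sr1 r1r; have r'1 := le_trans r'2 r21.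
  apply: le_trans (rnormD _ _) _; rewrite rnormN rnormZr ger0_norm ?subr_ge0 //.
  rewrite /L (mulrDl _ (rnorm w)); apply: lerD; last by rewrite mulrC.
  rewrite -(approx_trans _ _ sr rr').
  apply: (approx_lip n (le_trans s0 sr) rr' r'1 SKT0).
    exact: (approx_coeffE n sr yD).1.
  by apply: approx_coeff_bound => //; exact: le_trans rr' r'1.
move=> r r1r rr2 e' e'0.
have sr : s <= r := le_trans sr1 r1r; have r_1 := lt_le_trans rr2 r21.
have [a [aI ar [h0 h00 hh0]]] := approx_right_diff n yY s0 sr r_1 e'0.
have rt : `|r - t| < d / 2.
  move: r1t r2t; rewrite !ltr_norml => /andP[h1 h2] /andP[h3 h4].
  apply/andP; split; first by apply: lt_le_trans h1 _; rewrite lerB.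
  by apply: le_lt_trans h4; rewrite lerB // ltW.
exists h0 => // h hpos hh rh; rewrite fB.
have -> : r + h - r = h by rewrite addrC addKr.
have -> : approx n (r + h) s y - approx n r s y - h%:C *: w =
    (approx n (r + h) s y - approx n r s y - h%:C *: A a (approx n r s y)) +
    h%:C *: (A a (approx n r s y) - w) by rewrite scalerBr addrA subrK.
apply: le_trans (rnormD _ _) _; rewrite addrC mulrDl; apply: lerD; last exact: hh0.
rewrite rnormZr gtr0_norm // mulrC; apply: ler_wpM2r; first exact: ltW.
have d2d : d / 2 < d by rewrite ltr_pdivrMr // mulr_natr mulr2n ltrDl.
apply: hN => //; [exact: ltW|exact: lt_trans d2d|].
rewrite [d]splitr; apply: le_lt_trans (ler_distD r _ _) _.
by apply: ltrD rt; exact: lt_trans (hN' n N'n).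
Qed.

(** The velocity estimate with a = r, in the limit of n. *)
Lemma generator_cont y s t e : Y y -> 0 <= s -> s <= t -> t <= 1 -> 0 < e ->
  exists2 d, 0 < d & forall r, s <= r -> r <= 1 -> `|r - t| < d ->
    rnorm (A r (U r s y) - A t (U t s y)) <= e.
Proof.
move=> yY s0 st t1 e0.
have yD := max_cont_subspace_dom yY.
have [d [N [d0 hN]]] := propagator_velocity yY s0 st t1 e0.
exists d => // r sr r1 rt.
have rI : unitI r by rewrite /unitI /= r1 (le_trans s0 sr).
rewrite -(coeffA rI (propagator_coeffE s0 sr r1 yY).1).2.
have cv := coeff_cvg s0 sr r1 yY (admissible1 rI).
apply: (@rnorm_cvg_le_near _ _ _ _ _ N (cvgB cv (cvg_cst _))) => n Nn /=.
rewrite (coeffA rI (approx_coeffE n sr yD).1).2.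
exact: hN.
Qed.

(** * Existence *)

Lemma max_cont_subspace_lin c x y : Y x -> Y y -> Y (c *: x + y).
Proof.
move=> xY yY.
have xD := max_cont_subspace_dom xY; have yD := max_cont_subspace_dom yY.
have coeff_lin l : admissible l ->
    coeff (c *: x + y) l = c *: coeff x l + coeff y l.
  move=> [l0 lp hl]; have [lp'|pl] := leqP (size l) p; last first.
    have {}lp : size l = p.+1 by apply/eqP; rewrite eqn_leq lp.
    by rewrite !coeff_last // scalerDr !scalerA mulrC.
  have lk : size l = (size l).-1.+1 by rewrite prednK.
  have kp : ((size l).-1 < p)%N by rewrite -ltnS -lk ltnS.
  have cr := cube_row_of hl lk.
  have [[_ Clin] _] := hC kp cr.
  by rewrite !(coeffE C mu _ lk kp) Clin //; [exact: xD|exact: yD].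
apply: (max_cont_subspaceI (mu := mu)) => [k s kp cs|e e0].
  by have [[[_ dlin] _] _] := hC kp cs; apply: dlin; [exact: xD|exact: yD].
have c1 : 0 < complex.Re `|c| + 1.
  by rewrite ltr_wpDl // -ler0c RRe_real ?ger0_real.
have e2 : 0 < e / 2 by exact: divr_gt0.
have [d1 d10 h1] := max_cont_subspace_equi hmu xY (divr_gt0 e2 c1).
have [d2 d20 h2] := max_cont_subspace_equi hmu yY e2.
exists (Num.min d1 d2); first by rewrite lt_min d10.
move=> l l' al al' [sll' ll']; rewrite !coeff_lin // opprD addrACA -scalerBr.
have hx : rnorm (coeff x l - coeff x l') <= e / 2 / (complex.Re `|c| + 1).
  by apply: h1 => //; split => // i; apply: lt_le_trans (ll' i) _; rewrite ge_min lexx.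
have hy : rnorm (coeff y l - coeff y l') <= e / 2.
  by apply: h2 => //; split => // i; apply: lt_le_trans (ll' i) _; rewrite ge_min lexx orbT.
apply: le_trans (rnormD _ _) _; rewrite [e]splitr; apply: lerD hy.
rewrite rnormZ; move: hx; rewrite ler_pdivlMr // => /(le_trans _); apply.
by rewrite mulrC ler_wpM2l ?rnorm_ge0 // lerDl.
Qed.

Lemma max_cont_subspace_subspace : is_subspace Y.
Proof.
have Ylin := max_cont_subspace_lin; split=> [|c x y xY yY]; last exact: Ylin.
have [y yY _] := denseP hdense 0 (ltr01 : 0 < 1 :> R).
by rewrite -(addNr y) -scaleN1r; exact: Ylin.
Qed.

Lemma linear_map_bounded (f : X -> X) K : linear_map f ->
  (forall x, rnorm (f x) <= K * rnorm x) -> bounded_operator f.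
Proof.
move=> fl fK; split; first exact: fl.
by exists K => x; rewrite !rnormE -rmorphM lecR.
Qed.

Lemma propagator_C1_solution y s : Y y -> 0 <= s -> s <= 1 ->
  C1_solution A Y s y (fun t => U t s y).
Proof.
move=> yY s0 s1; split=> [|t /andP[st t1]|]; first exact: propagator_refl.
  have UY := propagator_Y s0 st t1 yY; split => //.
  have tI : unitI t by rewrite /unitI /= t1 (le_trans s0 st).
  exact: (coeffA tI (max_cont_subspace_dom UY)).1.
exists (fun t => A t (U t s y)); split => // [t /andP[st t1]|].
  apply/rnorm_cvgP => e e0.
  have [d d0 hd] := propagator_diff yY s0 st t1 e0.
  rewrite /prop_near1 /within /dnbhs /within /=; apply/nbhs_ballP; exists d => //= h.
  rewrite /ball /= sub0r normrN => hd0 hN0 /andP[sth th1].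
  have main : rnorm (U (t + h) s y - U t s y - h%:C *: A t (U t s y)) <= e * `|h|.
    have tt : `|t - t| < d by rewrite subrr normr0.
    have tht : `|t + h - t| < d by rewrite addrC addKr.
    (* The difference quotient is two-sided: t is the left or the right end point. *)
    have [h0|h0] := leP 0 h.
      have := hd t (t + h) st _ th1 tt tht.
      by rewrite [t + h - t]addrC addKr lerDl h0 => /(_ isT); rewrite ger0_norm.
    have := hd (t + h) t sth _ t1 tht tt.
    rewrite gerDl (ltW h0) => /(_ isT); rewrite opprD addrA subrr sub0r ltr0_norm //.
    by rewrite rmorphN scaleNr opprK -rnormN opprD opprB.
  have hpos : 0 < `|h| by rewrite normr_gt0.
  rewrite -(ler_pM2r hpos); apply: le_trans main.
  rewrite rnormB mulrC -rnormZr scalerBr scalerA -rmorphM divff //.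
  by rewrite scale1r.
apply/within_continuousP => t /andP[st t1] e e0.
have [d d0 hd] := generator_cont yY s0 st t1 e0.
exists d => // r /andP[sr r1]; rewrite /ball /= => tr.
by rewrite rnormB; apply: hd => //; rewrite distrC.
Qed.

Lemma propagator_evolution_system : evolution_system A Y U.
Proof.
split.
- split; [exact: max_cont_subspace_subspace|exact: hdense|move=> t tI y yY].
  exact: (coeffA tI (max_cont_subspace_dom yY)).1.
- move=> s t s0 st t1; apply: linear_map_bounded (propagator_lin s0 st t1) _ => x.
  exact: propagator_bound.
- by move=> y s yY s0 s1; apply: propagator_C1_solution => //; exact: ltW.
- by move=> r s t x r0 rs st t1; exact: propagator_trans.
move=> x; apply/within_continuousP => -[s t] /= [/andP[s0 s1] /andP[t0 t1] st] e e0.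
have [d d0 hd] := propagator_cont x e0.
exists d => // -[s' t'] /= [/andP[s'0 s'1] /andP[t'0 t'1] s't'] [/= ss' tt'].
exact: hd.
Qed.

(** * Uniqueness *)

Section Uniqueness.
Variable V : R -> R -> X -> X.
Hypothesis hV : evolution_system A Y V.

Lemma evolution_cont x s t e : 0 <= s -> s <= t -> t <= 1 -> 0 < e ->
  exists2 d, 0 < d & forall s' t', 0 <= s' -> s' <= t' -> t' <= 1 ->
    `|s - s'| < d -> `|t - t'| < d -> rnorm (V t s x - V t' s' x) <= e.
Proof.
move=> s0 st t1 e0; have [_ _ _ _ Vc] := hV.
have /within_continuousP/(_ (s, t)) := Vc x.
have DI (s' t' : R) : 0 <= s' -> s' <= t' -> t' <= 1 ->
    [/\ unitI s', unitI t' & s' <= t'].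
  move=> s'0 s't' t'1; split => //; rewrite /unitI /= ?s'0 ?t'1 ?andbT //.
    exact: le_trans s't' t'1.
  exact: le_trans s'0 s't'.
move=> /(_ (DI _ _ s0 st t1) e e0)[d d0 hd].
exists d => // s' t' s'0 s't' t'1 ss' tt'.
exact: (hd (s', t') (DI _ _ s'0 s't' t'1)).
Qed.

Lemma evolution_bounded s t : 0 <= s -> s <= t -> t <= 1 ->
  linear_map (V t s) /\ exists2 K, 0 < K & forall x, rnorm (V t s x) <= K * rnorm x.
Proof.
move=> s0 st t1; have [_ Vb _ _ _] := hV.
have [Vl [K hK]] := Vb s t s0 st t1; split => //.
exists (`|K| + 1); first by rewrite ltr_wpDl.
move=> x; have := hK x; rewrite !rnormE -rmorphM lecR => /le_trans; apply.
by apply: ler_wpM2r; [exact: rnorm_ge0|rewrite (le_trans (ler_norm K)) // lerDl].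
Qed.

(** With z = V(r,s) y in Y, both V(r+h,s) y and U(r+h,r) z equal z + h A(r) z up to
    o(h). Hence r |-> U(t,r) V(r,s) y has forward derivative zero. *)
Lemma evolution_unique_core y s t : Y y -> 0 <= s -> s < 1 -> s <= t -> t <= 1 ->
  V t s y = U t s y.
Proof.
move=> yY s0 s1 st t1; have [_ _ Vsol _ _] := hV.
have [Vs Vdom [y' [Vd _ Veq]]] := Vsol y s yY s0 s1.
have S0 := stab_const_ge0; have S1 := stab_const_gt0.
pose f r := U t r (V r s y).
suff : rnorm (f t - f s) <= 0 * (t - s).
  rewrite /f propagator_refl ?(le_trans s0 st) // Vs mul0r => h.
  apply/subr0_eq/rnorm0_eq0/eqP; by rewrite eq_le h rnorm_ge0.
apply: mean_value => // [r sr rt e e0|r sr rt e e0].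
  have r1 := le_trans rt t1; have r0 := le_trans s0 (ltW sr).
  have e2 : 0 < e / 2 by exact: divr_gt0.
  have e2S : 0 < e / 2 / S by exact: divr_gt0.
  have [d1 d10 hd1] := evolution_cont y s0 (ltW sr) r1 e2S.
  have [d2 d20 hd2] := propagator_cont (V r s y) e2.
  exists (Num.min d1 d2); first by rewrite lt_min d10.
  move=> r' sr' r'r; rewrite lt_min => /andP[h1 h2]; rewrite /f.
  have r'0 := le_trans s0 sr'; have r't := le_trans (ltW r'r) rt.
  apply: le_trans (rnorm_tri (U t r' (V r s y)) _ _) _; rewrite [e]splitr.
  have rr' : `|r - r'| = r - r' by rewrite gtr0_norm ?subr_gt0.
  apply: lerD.
    by apply: hd2; rewrite ?subrr ?normr0 ?rr'.
  rewrite -(linear_mapB (propagator_lin r'0 r't t1)).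
  apply: le_trans (propagator_bound r'0 r't t1 _) _.
  rewrite mulrC -ler_pdivlMr //.
  by apply: hd1; rewrite ?subrr ?normr0 ?rr' // (le_trans r't).
have r1 := lt_le_trans rt t1; have r0 := le_trans s0 sr.
have Jr : [set t | s <= t <= 1] r by rewrite /= sr ltW.
have [zY zD] := Vdom r Jr.
set z := V r s y in zY zD *.
have e2S : 0 < e / S / 2 by do 2!apply: divr_gt0 => //.
have := Vd r Jr; rewrite Veq // => /rnorm_cvgP/(_ _ e2S).
rewrite /prop_near1 /within /dnbhs /within /= => /nbhs_ballP[d1 /= d10 hd1].
have [d2 d20 hd2] := propagator_diff zY r0 (lexx r) (ltW r1) e2S.
exists (Num.min d1 d2); first by rewrite lt_min d10.
move=> h h0; rewrite lt_min => /andP[hh1 hh2] rht.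
have rh1 := le_trans rht t1; have rh0 : 0 <= r + h by rewrite addr_ge0 // ltW.
have rrh : r <= r + h by rewrite lerDl ltW.
rewrite /f -/z -(propagator_trans z r0 rrh rht t1).
rewrite -(linear_mapB (propagator_lin rh0 rht t1)).
apply: le_trans (propagator_bound rh0 rht t1 _) _.
have hU : rnorm (U (r + h) r z - z - h%:C *: A r z) <= e / S / 2 * h.
  have := hd2 r (r + h) (lexx r) rrh rh1; rewrite subrr normr0 => /(_ d20).
  rewrite [r + h - r]addrC addKr gtr0_norm // => /(_ hh2).
  by rewrite propagator_refl // ltW.
have hVd : rnorm (V (r + h) s y - z - h%:C *: A r z) <= e / S / 2 * h.
  have hN0 : h != 0 by rewrite gt_eqF.
  have hb : ball (0 : R) d1 h by rewrite /ball /= sub0r normrN gtr0_norm.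
  have Jh : s <= r + h <= 1 by rewrite rh1 (le_trans sr rrh).
  have := hd1 h hb hN0 Jh; rewrite -(ler_pM2r h0); apply: le_trans.
  rewrite rnormB mulrC -[X in _ <= X * _](gtr0_norm h0) -rnormZr scalerBr scalerA.
  by rewrite -rmorphM divff // scale1r.
have := rnormB3 (V (r + h) s y) (U (r + h) r z) z z (h%:C *: A r z) (h%:C *: A r z).
rewrite !subrr rnorm0 addr0 subr0 => hVU.
rewrite add0r; have -> : e * h = S * (e / S / 2 * h + e / S / 2 * h).
  by field; rewrite gt_eqF.
by apply: ler_wpM2l => //; exact: le_trans hVU (lerD hVd hU).
Qed.

(** Density of Y handles s < 1. At s = t = 1 the initial value problem says nothing,
    and V(1,1) is the limit of V(r,r) for r tending to 1 from below. *)
Lemma evolution_unique x s t : 0 <= s -> s <= t -> t <= 1 -> V t s x = U t s x.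
Proof.
move=> s0 st t1.
have below s' t' : 0 <= s' -> s' < 1 -> s' <= t' -> t' <= 1 -> V t' s' x = U t' s' x.
  move=> s'0 s'1 s't' t'1.
  have [Vl [K K0 hK]] := evolution_bounded s'0 s't' t'1.
  apply: (@rnorm_le_all _ _ (K + S)) => e e0.
  have [y yY xy] := denseP hdense x e0.
  apply: le_trans (rnorm_tri (V t' s' y) _ _) _; rewrite mulrDl.
  apply: lerD.
    by rewrite -(linear_mapB Vl); apply: le_trans (hK _) _; rewrite ler_pM2l.
  rewrite evolution_unique_core // -(linear_mapB (propagator_lin s'0 s't' t'1)).
  apply: le_trans (propagator_bound s'0 s't' t'1 _) _.
  by rewrite rnormB; apply: ler_wpM2l => //; exact: stab_const_ge0.
have [s1|s1] := ltP s 1; first exact: below.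
have es : s = 1 by apply/eqP; rewrite eq_le s1 (le_trans st t1).
have et : t = 1 by apply/eqP; rewrite eq_le t1 -es st.
rewrite es et propagator_refl //; apply: (@rnorm_le_all _ _ 1) => e e0.
rewrite mul1r; have [d d0 hd] := evolution_cont x ler01 (lexx 1) (lexx 1) e0.
pose r : R := Num.max (1 - d / 2) 0.
have r0 : 0 <= r by rewrite le_max lexx orbT.
have d20 : 0 < d / 2 by exact: divr_gt0.
have r1 : r < 1 by rewrite gt_max ltr01 andbT ltrBlDr ltrDl.
have dr : `|1 - r| < d.
  have : 1 - d / 2 <= r by rewrite le_max lexx.
  by rewrite gtr0_norm ?subr_gt0 //; lra.
have := hd r r r0 (lexx r) (ltW r1) dr dr.
by rewrite (below r r r0 r1 (lexx r) (ltW r1)) propagator_refl // ltW.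
Qed.

End Uniqueness.

End Approximation.

Theorem theorem2p3 (R : realType) (X : completeNormedModType R[i])
  (p : nat) (hp : (0 < p)%N)
  (A : R -> operator X) (E : R -> R -> X -> X)
  (hA : forall t : R, unitI t -> generates (A t) (E t))
  (M omega : R) (hM : 1 <= M) (hstable : stable E M omega)
  (C : forall k : nat, 'rV[R]_k.+1 -> operator X)
  (hC : forall (k : nat) (s : 'rV[R]_k.+1), (k < p)%N -> cube s ->
          closed_operator (C k s))
  (hC0 : forall s : R, unitI s -> op_eq (C 0%N (const_mx s)) (A s))
  (mu : 'rV[R]_p.+1 -> R[i]^o)
  (hcomm : forall (k : nat) (s : 'rV[R]_k.+1) (t tau : R),
     (k < p)%N -> cube s -> unitI t -> 0 <= tau ->
     op_ext (op_comp (C k s) (op_of (E t tau)))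
            (op_comp (op_of (E t tau)) (commutator_sum C mu s t tau)))
  (hdense : dense (max_cont_subspace p C))
  (hmu : {within @cube R p.+1, continuous mu}) :
  exists U : R -> R -> X -> X,
    evolution_system A (max_cont_subspace p C) U /\
    forall V : R -> R -> X -> X,
      evolution_system A (max_cont_subspace p C) V ->
      forall s t : R, 0 <= s -> s <= t -> t <= 1 ->
        forall x : X, V t s x = U t s x.
Proof.
exists (propagator E); split.
  exact: (propagator_evolution_system hp hA hM hstable hC0 hcomm hmu hdense hC).
move=> V hV s t s0 st t1 x.
exact: (evolution_unique hp hA hM hstable hC0 hcomm hmu hdense hC hV).
Qed.
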